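(* Let $R$ be a Noetherian ring and $s$ a positive integer. (a) If $s \le \dim R$, there exists a sequence $a_1,\ldots,a_s \in R$ that is weighted independent with respect to every weight sequence. (b) If $s > \dim R$, every sequence $a_1,\ldots,a_s \in R$ is weighted dependent with respect to every weight sequence.
   Context: All rings are commutative with identity; $\dim$ denotes Krull dimension. A weight sequence is an infinite sequence $\mathbf{w} = w_1,w_2,\ldots$ of positive integers; it makes $R[x_1,x_2,\ldots]$ a weighted graded ring with $\deg x_i = w_i$ (and elements of $R$ in degree $0$). For a polynomial $f$, $\operatorname{in}_{\mathbf{w}}(f)$ denotes the weighted homogeneous part of $f$ of least degree (with $\operatorname{in}_{\mathbf{w}}(0)=0$). A sequence $a_1,\ldots,a_s \in R$ is weighted dependent with respect to $\mathbf{w}$ if there is a polynomial $f \in R[x_1,\ldots,x_s]$ with $f(a_1,\ldots,a_s)=0$ such that at least one coefficient of $\operatorname{in}_{\mathbf{w}}(f)$ is invertible in $R$; otherwise it is weighted independent with respect to $\mathbf{w}$. (Coefficients are taken with respect to all monomials, so $0$ counts as a coefficient; this matters only for the zero ring.) *)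

(* Defs.v *)
From mathcomp Require Import all_boot all_order all_algebra.
From mathcomp Require Import finmap monalg.
From mathcomp Require Import boolp classical_sets constructive_ereal.

Set Implicit Arguments.
Unset Strict Implicit.
Unset Printing Implicit Defensive.

Import Order.TTheory GRing.Theory Num.Theory.

Local Open Scope classical_set_scope.
Local Open Scope ring_scope.

(* Rings are [comPzRingType]s, so that the zero ring is not excluded. This is  *)
(* also why ideals and polynomials are not those of [ring_quotient] and        *)
(* [mpoly], which are restricted to nontrivial rings.                          *)

Section KrullDimension.
Variable R : comPzRingType.

Definition is_ideal (I : set R) : Prop :=
  [/\ I 0,
      forall x y, I x -> I y -> I (x + y) &
      forall a x, I x -> I (a * x)].

Definition is_prime_ideal (P : set R) : Prop :=
  [/\ is_ideal P, ~ P 1 & forall x y, P (x * y) -> P x \/ P y].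

Definition noetherian : Prop :=
  forall I : set R, is_ideal I ->
    exists (n : nat) (g : 'I_n -> R),
      I = [set x | exists c : 'I_n -> R, x = \sum_(i < n) c i * g i].

(* P 0 < P 1 < ... < P n; the values of P beyond n are irrelevant. *)
Definition is_prime_chain (n : nat) (P : nat -> set R) : Prop :=
  (forall i, (i <= n)%N -> is_prime_ideal (P i)) /\
  (forall i, (i < n)%N -> P i `<` P i.+1).

(* The value is +oo if the chains have unbounded length, and -oo for the zero  *)
(* ring, which has no prime ideal.                                             *)
Definition krull_dim : \bar int :=
  supremum -oo%E
    [set (n%:Z)%:E%E | n in [set n | exists P, is_prime_chain n P]].

End KrullDimension.

(* The weight of the i-th variable is w i, for i starting from 0. *)
Definition weight_sequence (w : nat -> nat) : Prop := forall i, (0 < w i)%N.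

Section Weighted.
Variables (R : comPzRingType) (s : nat).

(* Only nontrivial R give {malg R[_]} its ring structure and [mmap], so that   *)
(* [peval] below writes out [mmap idfun _].                                    *)
Definition polynomials : Type := {malg R[{cmonom 'I_s}]}.

Definition peval (f : polynomials) (a : 'I_s -> R) : R :=
  \sum_(m <- msupp f) f@_m * \prod_(i < s) a i ^+ m i.

Definition wdeg (w : nat -> nat) (m : {cmonom 'I_s}) : nat :=
  (\sum_(i < s) m i * w i)%N.

Definition initial_form (w : nat -> nat) (f : polynomials) : polynomials :=
  [malg m in msupp f =>
    if all (fun m' => wdeg w m <= wdeg w m')%N (msupp f) then f@_m else 0].

Definition invertible (u : R) : Prop := exists v : R, u * v = 1.

(* m ranges over all monomials, so that for the zero ring every sequence is    *)
(* dependent, by f = 0.                                                        *)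
Definition weighted_dependent (w : nat -> nat) (a : 'I_s -> R) : Prop :=
  exists f : polynomials,
    peval f a = 0 /\ exists m, invertible (initial_form w f)@_m.

Definition weighted_independent (w : nat -> nat) (a : 'I_s -> R) : Prop :=
  ~ weighted_dependent w a.

End Weighted.

(* Main.v *)
Require Import Defs.
From HB Require Import structures.
From mathcomp Require Import all_boot all_order all_algebra.
From mathcomp Require Import finmap monalg.
From mathcomp Require Import boolp classical_sets constructive_ereal.
From mathcomp Require Import ring zify.

(** For a prime q, let l_q be the length of R_q-modules.

A chain of primes of length s ending at q forces l_q (R / q^(cn)) >= n^s for
some c (Artin-Rees and induction on s), whereas l_q (R / (a_1, ..., a_d)^n) is
O(n^d) when q is minimal over a_1, ..., a_d.

(a) Choose a_1, ..., a_s inside the top of a chain of primes of length s by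
prime avoidance, so that all primes containing them have height at least s, and
let q be minimal over them. A relation showing weighted dependence rewrites the
multiples of one fixed monomial M, so that in the filtration of R_q by weight
only monomials not divisible by M are needed; there are O(n^(s-1)) of these of
weight less than n, which contradicts the growth n^s.

(b) If a_1, ..., a_s are independent with respect to w, the possible
coefficients at minimal weight of their relations lie in a prime p. In the
extended Rees algebra of a_1, ..., a_s, with x_i = a_i T^(- w_i), the element T
and p generate a prime whose quotient is (R/p)[x_1, ..., x_s]. Pass to a
quotient domain in which all nonzero primes below this one contain T. Locally
it has dimension one, so its T-adic filtration induces ideals V_n of R with
p^(en) contained in V_n, while a form of weight n in the a_i with a coefficient
outside p is not in V_(n+1). Hence l_p (R / p^(en)) grows at least like n^s,
and the height of p is at least s. *)

Set Implicit Arguments.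
Unset Strict Implicit.
Unset Printing Implicit Defensive.

Import Order.TTheory GRing.Theory Num.Theory.

Local Open Scope classical_set_scope.
Local Open Scope ring_scope.

(** * Submodules over subrings and Hilbert's basis theorem *)

(** No localization, quotient module or length function is formed. Ideals stay subsets of R, passing
    to a quotient by Q means adding Q to the generators, and [length_ge] asserts lower bounds only,
    an upper bound being an implication from it. Only orders of growth in n are compared, so crude
    constants suffice as long as they do not depend on n; this is why [length_ge_filtration] yields
    one l for all filtrations.

    The two growth estimates also give Krull's principal ideal theorem: two primes Q < Q' strictly
    below a prime minimal over Q and one element would force growth n^2 against a linear bound. In
    (b) that theorem turns the condition that every nonzero ideal contains some t^n u, with u
    outside the prime, into dimension one.

    In (a) the rewriting may replace a monomial by others of the same weight, so it needs an order
    to terminate; an auxiliary weight without ties on the support of the relation supplies it. In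
    (b) the contradiction comes from d parameters of p, where d < s is its height: n^s would be
    O(n^d). *)

Section Submodules.
Variable A : comPzRingType.
Implicit Types (B G I J : set A) (x y : A).

Definition submodule B I : Prop :=
  [/\ I 0, forall x y, I x -> I y -> I (x + y) &
      forall b x, B b -> I x -> I (b * x)].

Definition span_over B G : set A :=
  [set x | forall I, submodule B I -> G `<=` I -> I x].

Definition is_subring B : Prop :=
  [/\ B 1, forall x y, B x -> B y -> B (x - y) &
      forall x y, B x -> B y -> B (x * y)].

(** Relative to a subset of an ambient ring, so that Rees algebras can be handled inside [{poly R}].
    For a subring [B] the sets [I] are its ideals. *)
Definition noetherian_sub B : Prop :=
  forall I, I `<=` B -> submodule B I ->
    exists2 G : seq A, [set` G] `<=` I & I `<=` span_over B [set` G].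

Lemma span_over_submodule B G : submodule B (span_over B G).
Proof.
split=> [I []|x y hx hy I hI hG|b x hb hx I hI hG] //; have [_ hD hM] := hI.
  by apply: hD; [apply: hx|apply: hy].
by apply: hM => //; apply: hx.
Qed.

Lemma sub_span_over B G : G `<=` span_over B G.
Proof. by move=> x Gx I _; apply. Qed.

Lemma span_over_min B G I : submodule B I -> G `<=` I -> span_over B G `<=` I.
Proof. by move=> hI hG x; apply. Qed.

Lemma span_overS B G G' : G `<=` G' -> span_over B G `<=` span_over B G'.
Proof.
move=> h; apply: span_over_min; first exact: span_over_submodule.
exact: subset_trans h (@sub_span_over _ _).
Qed.

Lemma subringD B x y : is_subring B -> B x -> B y -> B (x + y).
Proof.
move=> [h1 hB _] hx hy; have h0 : B 0 by rewrite -(subrr 1); apply: hB.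
by rewrite -[y]opprK; apply: (hB) => //; rewrite -[- y]add0r; apply: hB.
Qed.

Lemma subring0 B : is_subring B -> B 0.
Proof. by move=> [h1 hB _]; rewrite -(subrr 1); apply: hB. Qed.

Lemma subringN B x : is_subring B -> B x -> B (- x).
Proof.
move=> hB hx; rewrite -[- x]add0r; case: (hB) => _ h _; apply: h => //.
exact: subring0.
Qed.

Lemma subring_sum B (T : Type) (r : seq T) (P : pred T) F : is_subring B ->
  (forall i, P i -> B (F i)) -> B (\sum_(i <- r | P i) F i).
Proof.
move=> hB hF; apply: (big_ind B) => //; first exact: subring0.
by move=> x y; apply: subringD.
Qed.

Lemma subringX B x n : is_subring B -> B x -> B (x ^+ n).
Proof.
move=> hB hx; elim: n => [|n IHn]; first by rewrite expr0; case: hB.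
by rewrite exprS; case: hB => _ _; apply.
Qed.

Lemma noetherian_sub_acc B (F : nat -> set A) : noetherian_sub B ->
  (forall n, F n `<=` B /\ submodule B (F n)) ->
  (forall n, F n `<=` F n.+1) ->
  exists N, forall n, F n `<=` F N.
Proof.
move=> hB hF hS.
have mono n k : F n `<=` F (n + k)%N.
  elim: k => [|k IHk]; first by rewrite addn0.
  by rewrite addnS; apply: subset_trans IHk (hS _).
have mono' n k : (n <= k)%N -> F n `<=` F k by move=> /subnKC <-; apply: mono.
have [||G hG hI] := hB (\bigcup_n F n).
- by move=> x [n _]; apply: (hF n).1.
- split=> [|x y [n _ hx] [k _ hy]|b x hb [n _ hx]].
  + by exists 0%N => //; case: (hF 0%N) => _ [].
  + exists (maxn n k) => //; case: (hF (maxn n k)) => _ [_ hD _].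
    by apply: hD; [apply: (mono' n)|apply: (mono' k)] => //;
       rewrite ?leq_maxl ?leq_maxr.
  + by exists n => //; case: (hF n) => _ [_ _ hM]; apply: hM.
have [N hN] : exists N, [set` G] `<=` F N.
  elim: G hG {hI} => [|g G IHG] hG; first by exists 0%N.
  have [|N hN] := IHG; first by move=> x hx; apply: hG; rewrite /= inE hx orbT.
  have [k _ hk] : (\bigcup_n F n) g by apply: hG; rewrite /= mem_head.
  exists (maxn N k) => x /=; rewrite inE => /orP[/eqP->|hx].
    by apply: (mono' k) => //; rewrite leq_maxr.
  by apply: (mono' N); [rewrite leq_maxl|apply: hN].
exists N => n x hx; apply: (span_over_min (proj2 (hF N)) hN).
by apply: hI; exists n.
Qed.

Definition adjoin B y : set A :=
  [set x | exists (n : nat) (b : nat -> A),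
      (forall i, B (b i)) /\ x = \sum_(i < n) b i * y ^+ i].

(* The ideals of leading coefficients of the elements of degree at most d
   increase with d; once they are stationary, at d = D, the elements of degree
   at most D generate. *)
Lemma hilbert_basis B y : is_subring B -> noetherian_sub B ->
  noetherian_sub (adjoin B y).
Proof.
move=> sB nB I IB' sI.
have [B1 BB BM] := sB; have B0 := subring0 sB.
have [I0 ID IM] := sI.
have BB' x : B x -> adjoin B y x.
  move=> hx; exists 1%N, (fun _ => x); split=> //.
  by rewrite big_ord_recl big_ord0 expr0 mulr1 addr0.
have yB' n : adjoin B y (y ^+ n).
  exists n.+1, (fun i => (i == n)%:R); split=> [i|]; first by case: eqP.
  rewrite (bigD1 ord_max) //= eqxx mul1r big1 ?addr0 // => i /eqP hi.
  case: eqP => [e|]; last by rewrite mul0r.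
  by case: hi; apply: val_inj.
(* Powers of y may satisfy relations, so degree and leading coefficient belong to an expression in y
   and not to the element. *)
pose deglt n x := exists2 b : nat -> A, (forall i, B (b i)) &
   x = \sum_(i < n) b i * y ^+ i.
have degltD n x x' : deglt n x -> deglt n x' -> deglt n (x + x').
  move=> [b hb ->] [b' hb' ->]; exists (fun i => b i + b' i).
    by move=> i; apply: subringD.
  by rewrite -big_split; apply: eq_bigr => i _; rewrite mulrDl.
have degltM n c x : B c -> deglt n x -> deglt n (c * x).
  move=> hc [b hb ->]; exists (fun i => c * b i); first by move=> i; apply: BM.
  by rewrite mulr_sumr; apply: eq_bigr => i _; rewrite mulrA.
have degltX n x : deglt n x -> deglt n.+1 (y * x).
  move=> [b hb ->]; exists (fun i => if i is j.+1 then b j else 0).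
    by case.
  rewrite big_ord_recl mul0r add0r mulr_sumr; apply: eq_bigr => i _.
  by rewrite exprS mulrCA.
have degltS n x : deglt n.+1 x -> exists2 c, B c & deglt n (x - c * y ^+ n).
  move=> [b hb ->]; exists (b n) => //; exists b => //.
  by rewrite big_ord_recr addrK.
have degltW n x : deglt n x -> deglt n.+1 x.
  move=> [b hb ->]; exists (fun i => if (i < n)%N then b i else 0).
    by move=> i; case: ifP.
  rewrite big_ord_recr /= ltnn mul0r addr0.
  by apply: eq_bigr => i _; rewrite ltn_ord.
pose L d := [set c | B c /\ exists2 x, I x & deglt d (x - c * y ^+ d)].
have LB d : L d `<=` B /\ submodule B (L d).
  split; first by move=> c [].
  split=> [|c c' [hc [x Ix hx]] [hc' [x' Ix' hx']]|b c hb [hc [x Ix hx]]].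
  - split=> //; exists 0 => //; exists (fun _ => 0) => //.
    by rewrite mul0r subrr big1 // => i; rewrite mul0r.
  - split; first exact: subringD.
    exists (x + x'); first exact: ID.
    have -> : x + x' - (c + c') * y ^+ d = x - c * y ^+ d + (x' - c' * y ^+ d).
      by ring.
    exact: degltD.
  - split; first exact: BM.
    exists (b * x); first by apply: IM => //; apply: BB'.
    by rewrite -mulrA -mulrBr; apply: degltM.
have LS d : L d `<=` L d.+1.
  move=> c [hc [x Ix hx]]; split=> //; exists (y * x).
    by apply: IM => //; rewrite -[y]expr1.
  by rewrite exprS mulrCA -mulrBr; apply: degltX.
have [D hD] := noetherian_sub_acc nB LB LS.
have [G hG hGI] : exists2 G : seq A, [set` G] `<=` I &
    forall x, I x -> deglt D.+1 x -> span_over (adjoin B y) [set` G] x.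
  elim: (D.+1) => [|d [G hG IHG]].
    exists [::] => // x Ix [b hb ->]; rewrite big_ord0.
    by case: (span_over_submodule (adjoin B y) [set` [::]]).
  have [cs hcs hL] := nB (L d) (proj1 (LB d)) (proj2 (LB d)).
  have [z hz] : exists z : A -> A, forall c, L d c ->
      I (z c) /\ deglt d (z c - c * y ^+ d).
    have /choice[z hz] : forall c, exists x, L d c ->
        I x /\ deglt d (x - c * y ^+ d).
      move=> c; have [[_ [x Ix hx]]|] := pselect (L d c); first by exists x.
      by exists 0.
    by exists z.
  exists (G ++ [seq z c | c <- cs]) => [x /=|x Ix].
    rewrite mem_cat => /orP[/hG //|/mapP[c hc ->]].
    by apply: (hz c _).1; apply: hcs.
  move=> /degltS[c hc hx].
  have Lc : L d c by split=> //; exists x.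
  set Sp := span_over _ _; have sSp : submodule (adjoin B y) Sp.
    exact: span_over_submodule.
  have [Sp0 SpD SpM] := sSp.
  have [w Spw [Iw hw]] : exists2 w, Sp w & I w /\ deglt d (w - c * y ^+ d).
    apply: (hL c Lc [set c | exists2 w, Sp w & I w /\ deglt d (w - c * y ^+ d)]).
      split=> [|c1 c2 [w1 S1 [I1 h1]] [w2 S2 [I2 h2]]|b c1 hb [w1 S1 [I1 h1]]].
      + exists 0 => //; split=> //; exists (fun _ => 0) => //.
        by rewrite mul0r subrr big1 // => i; rewrite mul0r.
      + exists (w1 + w2); first exact: SpD.
        split; first exact: ID.
        have -> : w1 + w2 - (c1 + c2) * y ^+ d =
            w1 - c1 * y ^+ d + (w2 - c2 * y ^+ d) by ring.
        exact: degltD.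
      + exists (b * w1); first by apply: SpM => //; apply: BB'.
        split; first by apply: IM => //; apply: BB'.
        by rewrite -mulrA -mulrBr; apply: degltM.
    move=> c1 hc1; exists (z c1); last exact: hz (hcs _ hc1).
    by apply: sub_span_over; rewrite /= mem_cat map_f ?orbT.
  have B'N1 : adjoin B y (-1) by apply: BB'; apply: subringN.
  rewrite -[x](subrK w); apply: SpD => //.
  apply: (@span_overS _ [set` G]); first by move=> g /= hg; rewrite mem_cat hg.
  apply: IHG; first by apply: ID => //; rewrite -mulN1r; apply: IM.
  have -> : x - w = x - c * y ^+ d + (-1) * (w - c * y ^+ d) by ring.
  by apply: degltD => //; apply: degltM => //; apply: subringN.
exists G => // x Ix.
have sSp := span_over_submodule (adjoin B y) [set` G].
have [n [b [hb hx]]] := IB' _ Ix.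
have {b hb hx}: deglt n x by exists b.
have B'N1 : adjoin B y (-1) by apply: BB'; apply: subringN.
elim: n x Ix => [|n IHn] x Ix hx.
  by apply: hGI => //; elim: (D.+1) => [//|k]; apply: degltW.
have [nD|Dn] := leqP n D.
  apply: hGI => //; rewrite -(subnKC nD) -addSn.
  by elim: (D - n)%N => [|k IHk]; rewrite ?addn0 // addnS; apply: degltW.
have [c hc hxc] := degltS _ _ hx.
have [_ [w Iw hw]] : L D c by apply: (hD n); split=> //; exists x.
have [Sp0 SpD SpM] := sSp.
have Iyw : I (y ^+ (n - D) * w) by apply: IM.
rewrite -[x](subrK (y ^+ (n - D) * w)); apply: SpD; last first.
  apply: SpM => //; apply: hGI => //.
  rewrite -[w](subrK (c * y ^+ D)); apply: degltD; first exact: degltW.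
  apply: degltM => //; exists (fun i => (i == D)%:R) => [i|]; first by case: eqP.
  rewrite big_ord_recr /= eqxx mul1r big1 ?add0r // => i _.
  by rewrite ltn_eqF ?mul0r.
apply: IHn; first by apply: ID => //; rewrite -mulN1r; apply: IM.
have degltXn k z : deglt D z -> deglt (k + D)%N (y ^+ k * z).
  move=> hz; elim: k => [|k IHk]; first by rewrite expr0 mul1r.
  by rewrite exprS -mulrA addSn; apply: degltX.
have hy : deglt n (y ^+ (n - D) * (w - c * y ^+ D)).
  by rewrite -{1}(subnK (ltnW Dn)); apply: degltXn.
have -> : x - y ^+ (n - D) * w =
    x - c * y ^+ n + (-1) * (y ^+ (n - D) * (w - c * y ^+ D)).
  by rewrite -{2}(subnK (ltnW Dn)) exprD; ring.
by apply: degltD => //; apply: degltM => //; apply: subringN.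
Qed.

End Submodules.

(** * Ideals of a Noetherian ring *)

Section Ideals.
Variable R : comPzRingType.
Implicit Types (G I J P Q q p : set R) (x y : R).

Lemma is_idealE I : is_ideal I = submodule [set: R] I.
Proof.
apply/propext; split=> -[h0 hD hM]; split=> // a x; last exact: hM.
by move=> _; apply: hM.
Qed.

Definition span G : set R := span_over [set: R] G.

Lemma span_ideal G : is_ideal (span G).
Proof. by rewrite is_idealE; apply: span_over_submodule. Qed.

Lemma sub_span G : G `<=` span G.
Proof. exact: sub_span_over. Qed.

Lemma span_min G I : is_ideal I -> G `<=` I -> span G `<=` I.
Proof. by rewrite is_idealE; apply: span_over_min. Qed.

Lemma idealB I x y : is_ideal I -> I x -> I y -> I (x - y).
Proof. by move=> [_ hD hM] hx hy; rewrite -mulN1r; apply/hD/hM. Qed.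

Lemma idealMr I x y : is_ideal I -> I x -> I (x * y).
Proof. by move=> [_ _ hM] hx; rewrite mulrC; apply: hM. Qed.

Lemma ideal_sum I (T : Type) (r : seq T) (F : T -> R) : is_ideal I ->
  (forall i, I (F i)) -> I (\sum_(i <- r) F i).
Proof. by move=> [h0 hD _] hF; apply: big_ind. Qed.

Lemma span_set1 I x y : is_ideal I -> span (I `|` [set x]) y ->
  exists r, I (y - r * x).
Proof.
move=> hI; have [h0 hD hM] := hI; apply: (@span_min _ [set y | exists r, I (y - r * x)]).
  split=> [|y1 y2 [r1 h1] [r2 h2]|a y1 [r h]].
  - by exists 0; rewrite mul0r subr0.
  - exists (r1 + r2).
    have -> : y1 + y2 - (r1 + r2) * x = y1 - r1 * x + (y2 - r2 * x) by ring.
    exact: hD.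
  - by exists (a * r); rewrite -mulrA -mulrBr; apply: hM.
move=> z [hz|->]; first by exists 0; rewrite mul0r subr0.
by exists 1; rewrite mul1r subrr.
Qed.

Lemma noetherian_subT : noetherian R -> noetherian_sub [set: R].
Proof.
move=> hR I _; rewrite -is_idealE => hI; have [n [g hg]] := hR I hI.
exists (codom g) => [x /= /codomP[i ->]|x].
  rewrite hg; exists (fun j => (j == i)%:R).
  rewrite (bigD1 i) //= eqxx mul1r big1 ?addr0 // => j /negbTE->.
  by rewrite mul0r.
rewrite hg -/(span _) => -[c ->].
apply: (@ideal_sum (span _)) => [|i]; first exact: span_ideal.
have [_ _ hM] := span_ideal [set` codom g]; apply: hM.
by apply: sub_span => /=; apply: codom_f.
Qed.

Definition noeth := noetherian_sub [set: R].

Lemma noeth_max (F : set (set R)) I : noeth ->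
  (forall J, F J -> is_ideal J) -> F I ->
  exists M, [/\ F M, I `<=` M & forall J, F J -> M `<=` J -> J `<=` M].
Proof.
move=> hR hF FI; apply: contrapT => hn.
have /choice[f hf] : forall M, exists J, F M -> I `<=` M ->
    [/\ F J, M `<=` J & ~ J `<=` M].
  move=> M; have [[FM IM]|h] := pselect (F M /\ I `<=` M); last first.
    by exists M => h1 h2; case: h; split.
  apply: contrapT => h; apply: hn; exists M; split=> // J FJ MJ.
  by apply: contrapT => JM; apply: h; exists J.
have hG n : F (iter n f I) /\ I `<=` iter n f I.
  elim: n => [|n [FM IM]]; first by split.
  have [FJ MJ _] := hf _ FM IM.
  by split=> //; apply: subset_trans MJ.
have [n|n|N hN] := @noetherian_sub_acc _ _ (fun n => iter n f I) hR.
- by split=> //; rewrite -is_idealE; apply/hF/(hG n).1.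
- by have [] := hf _ (hG n).1 (hG n).2.
- by have [_ _] := hf _ (hG N).1 (hG N).2; apply; apply: (hN N.+1).
Qed.

(** An ideal maximal among those disjoint from a multiplicative set is prime. The last clause keeps
    the maximality, which later says that each nonzero ideal of a quotient domain meets the image of
    [U]. *)
Lemma exists_prime_avoiding (U : set R) I : noeth -> is_ideal I ->
  U 1 -> (forall x y, U x -> U y -> U (x * y)) -> (forall x, U x -> ~ I x) ->
  exists P, [/\ is_prime_ideal P, I `<=` P, forall x, U x -> ~ P x &
    forall J, is_ideal J -> P `<=` J -> ~ J `<=` P -> exists2 x, U x & J x].
Proof.
move=> hR hI U1 UM UI.
have [J []//|//|P [[hP UP] IP hmax]] :=
  @noeth_max [set J | is_ideal J /\ forall x, U x -> ~ J x] I hR.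
have hbig J : is_ideal J -> P `<=` J -> ~ J `<=` P -> exists2 x, U x & J x.
  move=> hJ PJ nJP; apply: contrapT => h; apply/nJP/hmax => //; split=> // x Ux Jx.
  by apply: h; exists x.
exists P; split=> //; split=> //; first exact: UP.
move=> x y Pxy; apply: contrapT => /not_orP[nx ny].
have aux z : ~ P z -> exists2 v, U v & exists r, P (v - r * z).
  move=> nz; have [||v Uv] := hbig _ (span_ideal (P `|` [set z])).
  - by move=> v Pv; apply: sub_span; left.
  - by move=> h; apply: nz; apply: h; apply: sub_span; right.
  - by exists v => //; apply: span_set1.
have [v Uv [r hv]] := aux x nx; have [v' Uv' [r' hv']] := aux y ny.
apply: (UP (v * v')); first exact: UM.
have [_ hD hM] := hP.
have -> : v * v' = v' * (v - r * x) + (r * x) * (v' - r' * y) + r * r' * (x * y).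
  by ring.
by apply: (hD); [apply: (hD)|]; apply: hM.
Qed.

Definition imul I J : set R := span [set z | exists x y, [/\ I x, J y & z = x * y]].

Fixpoint ipow I n : set R := if n is m.+1 then imul I (ipow I m) else [set: R].

Definition iprod (ps : seq (set R)) : set R := foldr imul [set: R] ps.

Lemma imul_ideal I J : is_ideal (imul I J).
Proof. exact: span_ideal. Qed.

Lemma mem_imul I J x y : I x -> J y -> imul I J (x * y).
Proof. by move=> hx hy; apply: sub_span; exists x, y. Qed.

Lemma imul_min I J K : is_ideal K ->
  (forall x y, I x -> J y -> K (x * y)) -> imul I J `<=` K.
Proof. by move=> hK h; apply: span_min => // _ [x [y [hx hy ->]]]; apply: h. Qed.

Lemma ipow_ideal I n : is_ideal (ipow I n).
Proof. by case: n => [|n] //=; apply: imul_ideal. Qed.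

Lemma colon_ideal I x : is_ideal I -> is_ideal [set y | I (x * y)].
Proof.
move=> [h0 hD hM]; split=> /= [|y z hy hz|a y hy]; first by rewrite mulr0.
  by rewrite mulrDr; apply: hD.
by rewrite mulrCA; apply: hM.
Qed.

Lemma ipowS I n : is_ideal I -> ipow I n.+1 `<=` ipow I n.
Proof.
move=> hI; elim: n => [|n IHn] //; apply: imul_min; first exact: ipow_ideal.
by move=> x y hx hy; apply: mem_imul => //; apply: IHn.
Qed.

Lemma ipow_le I m n : is_ideal I -> (m <= n)%N -> ipow I n `<=` ipow I m.
Proof.
move=> hI /subnKC<-; elim: (n - m)%N => [|k IHk]; first by rewrite addn0.
by rewrite addnS; apply: subset_trans IHk; apply: ipowS.
Qed.

Lemma mem_ipowD I m n x y : ipow I m x -> ipow I n y -> ipow I (m + n)%N (x * y).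
Proof.
move=> hx hy; elim: m x hx => [|m IHm] x /= hx.
  by rewrite add0n; have [_ _ hM] := ipow_ideal I n; apply: hM.
pose K := [set x | ipow I (m + n).+1 (y * x)].
suff h : imul I (ipow I m) `<=` K by rewrite mulrC; apply: h.
apply: imul_min; first exact/colon_ideal/ipow_ideal.
by move=> u v hu hv; rewrite /K /= mulrCA [y * v]mulrC; apply: mem_imul => //; apply: IHm.
Qed.

Lemma ipow1 I x : I x -> ipow I 1 x.
Proof. by move=> hx; rewrite -[x]mulr1; apply: mem_imul. Qed.

Lemma ipowS_sub I n : is_ideal I -> ipow I n.+1 `<=` I.
Proof. by move=> hI; apply: imul_min => // x y hx _; apply: idealMr. Qed.

Lemma iprod_cat ps1 ps2 K : is_ideal K ->
  (forall u v, iprod ps1 u -> iprod ps2 v -> K (u * v)) ->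
  iprod (ps1 ++ ps2) `<=` K.
Proof.
elim: ps1 K => [|P ps1 IH] K hK h /=.
  by move=> v hv; rewrite -[v]mul1r; apply: h.
apply: imul_min => // x y hx hy.
apply: (IH [set y | K (x * y)]) => // [|u v hu hv /=]; first exact: colon_ideal.
by rewrite mulrA; apply: h => //; apply: mem_imul.
Qed.

Lemma iprod_sub_prime ps P : is_prime_ideal P -> iprod ps `<=` P ->
  exists2 Q, Q \in ps & Q `<=` P.
Proof.
move=> [hP P1 hM]; elim: ps => [|Q ps IH] h; first by case: P1; apply: h.
have [hQ|] := pselect (Q `<=` P); first by exists Q; rewrite ?mem_head.
move=> /existsNP[x /not_implyP[Qx nPx]].
case: IH => [y hy|Q' hQ' ?]; last by exists Q'; rewrite // inE hQ' orbT.
by have [] := hM x y (h _ (mem_imul Qx hy)).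
Qed.

(** Noetherian induction: an ideal that is neither prime nor the whole ring contains the product of
    two strictly larger ideals. The list contains all primes minimal over [I], and thus does the
    work of a primary decomposition. *)
Lemma prime_cover I : noeth -> is_ideal I ->
  exists2 ps : seq (set R),
    (forall P, P \in ps -> is_prime_ideal P /\ I `<=` P) & iprod ps `<=` I.
Proof.
move=> hR hI; apply: contrapT => hn.
pose covered J := exists2 ps : seq (set R),
    (forall P, P \in ps -> is_prime_ideal P /\ J `<=` P) & iprod ps `<=` J.
have [J []//|//|M [[hM nM] _ hmax]] :=
  @noeth_max [set J | is_ideal J /\ ~ covered J] I hR.
have cov J : is_ideal J -> M `<=` J -> ~ J `<=` M -> covered J.
  by move=> hJ MJ nJM; apply: contrapT => h; apply/nJM/hmax.
have [M0 MD MM] := hM.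
have M1 : ~ M 1.
  move=> h; apply: nM; exists [::] => // x _.
  by rewrite -[x]mulr1; apply: MM.
have [x [y [Mxy nx ny]]] : exists x y, [/\ M (x * y), ~ M x & ~ M y].
  apply: contrapT => h; apply: nM; exists [:: M] => [P|].
    rewrite inE => /eqP->; split=> //; split=> // x y Mxy.
    by apply: contrapT => /not_orP[nx ny]; apply: h; exists x, y.
  by apply: imul_min => // x y hx _; apply: idealMr.
have aux z : ~ M z -> covered (span (M `|` [set z])).
  move=> nz; apply: cov; first exact: span_ideal.
    by move=> v hv; apply: sub_span; left.
  by move=> h; apply: nz; apply: h; apply: sub_span; right.
have [ps1 hp1 h1] := aux x nx; have [ps2 hp2 h2] := aux y ny.
apply: nM; exists (ps1 ++ ps2) => [P|].
  rewrite mem_cat => /orP[/hp1|/hp2] [? h]; split=> // v hv;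
    by apply: h; apply: sub_span; left.
apply: iprod_cat => // u v /h1/(span_set1 hM)[r hr] /h2/(span_set1 hM)[r' hr'].
have -> : u * v = v * (u - r * x) + (r * x) * (v - r' * y) + r * r' * (x * y).
  by ring.
by apply: (MD); [apply: (MD)|]; apply: MM.
Qed.

Lemma seq_min_set (ps : seq (set R)) p : exists q,
  [/\ q = p \/ q \in ps, q `<=` p & forall P, P \in ps -> P `<=` q -> q `<=` P].
Proof.
elim: ps p => [|P ps IH] p; first by exists p; split=> //; left.
have [q [hq qp hmin]] := IH p.
have [Pq|nPq] := pselect (P `<=` q).
  have [q' [hq' q'P hmin']] := IH P; exists q'; split.
  - by right; rewrite inE; case: hq' => [->|->]; rewrite ?eqxx ?orbT.
  - by apply: subset_trans qp; apply: subset_trans Pq.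
  - by move=> P'; rewrite inE => /orP[/eqP->|/hmin'].
exists q; split=> //; first by case: hq => h; [left|right; rewrite inE h orbT].
by move=> P'; rewrite inE => /orP[/eqP->|/hmin].
Qed.

(** * Minimal primes and prime avoidance *)

Definition minimal_prime I q := [/\ is_prime_ideal q, I `<=` q &
  forall Q, is_prime_ideal Q -> I `<=` Q -> Q `<=` q -> q `<=` Q].

Lemma exists_minimal_prime I p : noeth -> is_ideal I -> is_prime_ideal p ->
  I `<=` p -> exists2 q, minimal_prime I q & q `<=` p.
Proof.
move=> hR hI hp Ip; have [ps hps hI'] := prime_cover hR hI.
have [q [hq qp hmin]] := seq_min_set ps p.
have [hq' Iq] : is_prime_ideal q /\ I `<=` q by case: hq => [->|/hps].
exists q => //; split=> // Q hQ IQ Qq.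
have [P hP PQ] := iprod_sub_prime hQ (subset_trans hI' IQ).
by apply: (subset_trans _ PQ); apply: hmin => //; apply: subset_trans Qq.
Qed.

(** Among the primes of a cover of [I], those contained in q equal q by minimality and are counted
    by k; each of the others has an element outside q, and u is the product of these. *)
Lemma minimal_prime_pow I q : noeth -> is_ideal I -> minimal_prime I q ->
  exists k u, ~ q u /\ forall x, ipow q k x -> I (u * x).
Proof.
move=> hR hI [hq Iq hmin]; have [ps hps hI'] := prime_cover hR hI.
suff : exists k u, ~ q u /\ forall x, ipow q k x -> iprod ps (u * x).
  by move=> [k [u [nu h]]]; exists k, u; split=> // x /h; apply: hI'.
elim: ps hps {hI'} => [|P ps IH] hps.
  by exists 0%N, 1; split=> //; case: hq.
have [|k [u [nu hu]]] := IH.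
  by move=> Q hQ; apply: hps; rewrite inE hQ orbT.
have [hP IP] := hps P (mem_head _ _).
have [Pq|/existsNP[v /not_implyP[Pv nqv]]] := pselect (P `<=` q).
  exists k.+1, u; split=> //; apply: (@imul_min _ _ [set x | iprod (P :: ps) (u * x)]).
    exact/colon_ideal/imul_ideal.
  move=> x y qx hy /=; rewrite mulrCA; apply: mem_imul; last exact: hu.
  exact: (hmin P).
exists k, (v * u); split=> [|x hx].
  by case: hq => _ _ hM /hM[].
by rewrite -mulrA; apply: mem_imul => //; apply: hu.
Qed.

Lemma prime_avoidance p (ps : seq (set R)) : is_ideal p ->
  (forall P, P \in ps -> is_prime_ideal P) ->
  exists2 a, p a & forall P, P \in ps -> ~ p `<=` P -> ~ P a.
Proof.
move=> hp; have [p0 pD pM] := hp.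
have [n] := ubnP (size ps); elim: n ps => // n IHn [|P ps] hs hps.
  by exists 0.
have hP := hps P (mem_head _ _); have [hPi P1 PM] := hP.
have hps' Q : Q \in ps -> is_prime_ideal Q.
  by move=> hQ; apply: hps; rewrite inE hQ orbT.
have [pP|npP] := pselect (p `<=` P).
  have [a pa ha] := IHn ps hs hps'.
  by exists a => // Q; rewrite inE => /orP[/eqP->|/ha].
pose ps' := [seq Q <- ps | ~~ `[< Q `<=` P >]].
have [||a pa ha] := IHn ps'.
- by rewrite size_filter; apply: leq_ltn_trans (count_size _ _) _.
- by move=> Q; rewrite mem_filter => /andP[_]; apply: hps'.
have [b [pb hb nb]] : exists b, [/\ p b, forall Q, Q \in ps' -> Q b & ~ P b].
  have : forall Q, Q \in ps' -> is_ideal Q /\ ~ Q `<=` P.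
    move=> Q; rewrite mem_filter => /andP[/asboolPn h /hps'[? _ _]] //.
  elim: ps' {ha} => [|Q qs IHq] hqs.
    by move: npP => /existsNP[b /not_implyP[]]; exists b.
  have [|b [pb hb nb]] := IHq; first by move=> Q' h; apply: hqs; rewrite inE h orbT.
  have [[_ _ QM]] := hqs Q (mem_head _ _).
  move=> /existsNP[v /not_implyP[Qv nPv]].
  exists (v * b); split; first exact: pM.
    move=> Q'; rewrite inE => /orP[/eqP->|hQ']; first by rewrite mulrC; apply: QM.
    have [|[_ _ Q'M] _] := hqs Q'; first by rewrite inE hQ' orbT.
    by apply: Q'M; apply: hb.
  by move=> /PM[].
have [Pa|nPa] := pselect (P a).
  have nPab : ~ P (a + b).
    by move=> h; apply: nb; rewrite -[b](addKr a) addrC; apply: idealB.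
  exists (a + b); first exact: pD.
  move=> Q; rewrite inE => /orP[/eqP->//|hQ] npQ.
  have [QP|nQP] := pselect (Q `<=` P); first by move=> /QP.
  have hQ' : Q \in ps' by rewrite mem_filter hQ andbT; apply/asboolPn.
  move=> h; apply: (ha Q) => //; rewrite -[a](addrK b).
  by apply: idealB => //; [case: (hps' _ hQ)|apply: hb].
exists a => // Q; rewrite inE => /orP[/eqP->//|hQ] npQ.
have [QP|nQP] := pselect (Q `<=` P); first by move=> /QP.
by apply: ha => //; rewrite mem_filter hQ andbT; apply/asboolPn.
Qed.

End Ideals.

(** * Lengths over the localization at a prime *)

Section Lengths.
Variable R : comPzRingType.
Implicit Types (G H Q q : set R) (x y g : R).

(* The contraction to R of the ideal generated by G in the localization at q. *)
Definition localspan q G : set R :=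
  [set x | exists2 u, ~ q u & span G (u * x)].

(* The length of R / G over the localization at q is at least n. *)
Fixpoint length_ge q G n : Prop :=
  if n is m.+1 then
    exists2 x, ~ localspan q G x & length_ge q (G `|` [set x]) m
  else True.

Variable q : set R.
Hypothesis hq : is_prime_ideal q.
Local Notation cl := (localspan q).
Local Notation lg := (length_ge q).

Let q1 : ~ q 1. Proof. by case: hq. Qed.

Let qM x y : ~ q x -> ~ q y -> ~ q (x * y).
Proof. by case: hq => _ _ h nx ny /h[]. Qed.

Lemma span_localspan G : span G `<=` cl G.
Proof. by move=> x hx; exists 1 => //; rewrite mul1r. Qed.

Lemma sub_localspan G : G `<=` cl G.
Proof. by move=> x hx; apply: span_localspan; apply: sub_span. Qed.

Lemma localspan_ideal G : is_ideal (cl G).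
Proof.
have [h0 hD hM] := span_ideal G; split.
- exact: span_localspan.
- move=> x y [u nu hu] [v nv hv]; exists (u * v); first exact: qM.
  have -> : u * v * (x + y) = v * (u * x) + u * (v * y) by ring.
  by apply: (hD); apply: hM.
- by move=> a x [u nu hu]; exists u => //; rewrite mulrCA; apply: hM.
Qed.

Lemma localspan_cancel G u x : ~ q u -> cl G (u * x) -> cl G x.
Proof.
by move=> nu [v nv hv]; exists (v * u); [apply: qM|rewrite -mulrA].
Qed.

Lemma localspan_min G H : G `<=` cl H -> cl G `<=` cl H.
Proof.
move=> h x [u nu hu]; apply: (localspan_cancel nu).
by apply: (span_min _ h hu); apply: localspan_ideal.
Qed.

Lemma localspanS G H : G `<=` H -> cl G `<=` cl H.
Proof. by move=> h; apply: localspan_min => x /h; apply: sub_localspan. Qed.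

Lemma localspan_set1 G g x : cl (G `|` [set g]) x ->
  exists u r, ~ q u /\ cl G (u * x - r * g).
Proof.
move=> [u nu hu]; have [||r hr] := @span_set1 _ (span G) g (u * x).
- exact: span_ideal.
- apply: (span_min _ _ hu); first exact: span_ideal.
  by move=> y [hy|hy]; apply: sub_span; [left; apply: sub_span|right].
- by exists u, r; split=> //; apply: span_localspan.
Qed.

Lemma length_geS G H n : G `<=` cl H -> lg H n -> lg G n.
Proof.
elim: n G H => [|n IHn] G H GH //= [x nx hx].
exists x; first by move=> hGx; apply: nx; apply: (localspan_min GH).
apply: IHn hx => y [hy|->]; last by apply: sub_localspan; right.
by apply: localspanS (GH _ hy) => z; left.
Qed.

Lemma length_ge_le G m n : (m <= n)%N -> lg G n -> lg G m.
Proof.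
elim: m n G => [|m IHm] [|n] G //= mn [x nx hx].
by exists x => //; apply: IHm hx.
Qed.

(** Modulo [G] the element g is killed by q, so it generates a module that is zero or simple over
    the localization, and dividing by it costs at most one step of a chain. *)
Lemma length_ge_setU1 G g n : (forall t, q t -> cl G (t * g)) ->
  lg G n.+1 -> lg (G `|` [set g]) n.
Proof.
elim: n G => [|n IHn] G hg // [x nx hx].
have [hgx|ngx] := pselect (cl (G `|` [set x]) g).
  apply: (@length_geS _ (G `|` [set x]) n.+1) => // y [hy|->] //.
  by apply: sub_localspan; left.
exists x.
  move=> /localspan_set1[u [r [nu hu]]].
  have [_ hD hM] := localspan_ideal G.
  have [qr|nqr] := pselect (q r).
    apply: nx; apply: (localspan_cancel nu); rewrite -[u * x](subrK (r * g)).
    by apply: hD => //; apply: hg.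
  apply: ngx; apply: (localspan_cancel nqr).
  have [_ hD' hM'] := localspan_ideal (G `|` [set x]).
  have -> : r * g = (-1) * (u * x - r * g) + u * x by ring.
  apply: hD'; apply: hM'; last by apply: sub_localspan; right.
  by apply: localspanS hu => y; left.
apply: (@length_geS _ (G `|` [set x] `|` [set g])).
  by move=> y [[hy|hy]|hy]; apply: sub_localspan; [left; left|right|left; right].
apply: IHn => // t qt; apply: localspanS (hg t qt) => y; by left.
Qed.

(** Superadditivity along 0 -> R/(G : x) -> R/G -> R/(G + (x)) -> 0 at q: a chain over [H],
    multiplied by x, is followed by a chain over G + (x). *)
Lemma length_ge_colon G H x m n :
  (forall r, cl G (r * x) -> cl H r) ->
  lg (G `|` [set x]) m -> lg H n -> lg G (n + m).
Proof.
elim: n G H => [|n IHn] G H hcol hm /=.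
  by move=> _; apply: length_geS hm => y hy; apply: sub_localspan; left.
move=> [y ny hy]; exists (y * x); first by move=> /hcol.
apply: IHn hy.
- move=> r /localspan_set1[u [t [nu hu]]]; apply: (localspan_cancel nu).
  have -> : u * r = (u * r - t * y) + t * y by ring.
  have [_ hD hM] := localspan_ideal (H `|` [set y]).
  apply: hD; last by apply: hM; apply: sub_localspan; right.
  apply: (@localspanS H); first by move=> z; left.
  by apply: hcol; rewrite mulrBl -!mulrA.
- apply: length_geS hm => z [[hz|->]|->].
  + by apply: sub_localspan; left.
  + have [_ _ hM] := localspan_ideal (G `|` [set x]).
    by apply: hM; apply: sub_localspan; right.
  + by apply: sub_localspan; right.
Qed.

(** Locally, the module generated by g modulo [G] is a quotient of R/G0. Its length is at most the
    number l of chosen generators of the powers q^i with i < e, since q kills each layer; l does not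
    depend on g and [G]. *)
Lemma length_ge_setU1_fin G0 e : noeth R -> ipow q e `<=` cl G0 ->
  exists l, forall g G n, (forall t, G0 t -> cl G (t * g)) ->
    lg G (l + n) -> lg (G `|` [set g]) n.
Proof.
move=> hR; elim: e G0 => [|e IHe] G0 hG0.
  exists 0%N => g G n hg; apply: length_geS => y [hy|->].
    exact: sub_localspan.
  have [u nu hu] := hG0 1 I; apply: (localspan_cancel nu).
  rewrite mulr1 in hu.
  apply: (@span_min _ G0 [set t | cl G (t * g)] _ _ _ hu) => //.
  have [h0 hD hM] := localspan_ideal G.
  split=> [|x z hx hz|a x hx] /=; first by rewrite mul0r.
    by rewrite mulrDl; apply: hD.
  by rewrite -mulrA; apply: hM.
have [//||ys hys hys'] := hR (ipow q e).
  by rewrite -is_idealE; apply: ipow_ideal.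
have [|l hl] := IHe (G0 `|` [set` ys]).
  apply: subset_trans hys' _; apply: subset_trans (@span_localspan _).
  by apply: span_min; [apply: span_ideal|move=> y hy; apply: sub_span; right].
exists (size ys + l)%N => g G n hg hlg.
suff : forall ys', {subset ys' <= ys} -> forall m, lg G (size ys' + m) ->
    lg (G `|` [set y * g | y in [set` ys']]) m.
  move=> /(_ ys (fun _ h => h) (l + n)%N); rewrite addnA => /(_ hlg) h.
  apply: (@length_geS _ (G `|` [set y * g | y in [set` ys]] `|` [set g])).
    by move=> y [hy|hy]; apply: sub_localspan; [left; left|right].
  apply: hl h => t [ht|ht].
    by apply: localspanS (hg t ht) => y; left.
  by apply: sub_localspan; right; exists t.
elim=> [|y ys0 IHys] hsub m /= h.
  by apply: length_geS h => z [hz|[? //]]; apply: sub_localspan.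
apply: (@length_geS _ ((G `|` [set y * g | y in [set` ys0]]) `|` [set y * g])).
  move=> z [hz|[t /=]]; first by apply: sub_localspan; left; left.
  rewrite inE => /orP[/eqP-> <-|ht <-]; first by apply: sub_localspan; right.
  by apply: sub_localspan; left; right; exists t.
apply: length_ge_setU1; last first.
  by apply: IHys; [move=> z hz; apply: hsub; rewrite inE hz orbT|rewrite addnS].
move=> t qt; rewrite mulrA.
have hty : cl G0 (t * y).
  by apply: hG0; apply: mem_imul => //; apply: hys; apply: hsub; apply: mem_head.
have [u nu hu] := hty; apply: (localspan_cancel nu).
rewrite mulrA.
apply: (@span_min _ G0
  [set t | cl (G `|` [set y * g | y in [set` ys0]]) (t * g)] _ _ _ hu) =>
  [|z hz /=].
  have [h0 hD hM] := localspan_ideal (G `|` [set y * g | y in [set` ys0]]).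
  split=> [|x z hx hz|a x hx] /=; first by rewrite mul0r.
    by rewrite mulrDl; apply: hD.
  by rewrite -mulrA; apply: hM.
by apply: localspanS (hg z hz) => x; left.
Qed.

(** The layer between [K j] and [K j.+1] is generated by [E j] and killed by [G0], so each generator
    contributes at most l, the uniform bound of [length_ge_setU1_fin]. The sets [K j] are mere
    generating sets. *)
Lemma length_ge_filtration Q G0 e : noeth R -> ipow q e `<=` cl G0 ->
  exists l, forall (K : nat -> set R) (E : nat -> seq R) n m,
    K 0%N 1 ->
    (forall j, (j < n)%N -> K j `<=` cl (Q `|` K j.+1 `|` [set` E j])) ->
    (forall j g t, (j < n)%N -> g \in E j -> G0 t ->
       cl (Q `|` K j.+1) (t * g)) ->
    lg (Q `|` K n) m -> (m <= l * \sum_(j < n) size (E j))%N.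
Proof.
move=> hR hG0; have [l hl] := length_ge_setU1_fin hR hG0.
have hseq (ys : seq R) G m : (forall g t, g \in ys -> G0 t -> cl G (t * g)) ->
    lg G (l * size ys + m) -> lg (G `|` [set` ys]) m.
  elim: ys m => [|y ys IH] m hys h /=.
    rewrite muln0 in h.
    by apply: length_geS h => z [hz|//]; apply: sub_localspan.
  apply: (@length_geS _ ((G `|` [set` ys]) `|` [set y])).
    move=> z [hz|/=]; first by apply: sub_localspan; left; left.
    rewrite inE => /orP[/eqP->|ht]; first by apply: sub_localspan; right.
    by apply: sub_localspan; left; right.
  apply: hl; last first.
    by apply: IH; [move=> g t hg; apply: hys; rewrite inE hg orbT|
                   move: h; rewrite /= mulnS addnCA addnA].
  move=> t ht; apply: (@localspanS G); first by move=> z; left.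
  by apply: hys => //; apply: mem_head.
exists l => K E n m K0 hK hE h; rewrite leqNgt; apply/negP => hm.
have hn k r : (k <= n)%N -> lg (Q `|` K k) (l * \sum_(j < k) size (E j) + r) ->
    lg (Q `|` K 0%N) r.
  elim: k r => [|k IHk] r kn; first by rewrite big_ord0 muln0.
  rewrite big_ord_recr /= mulnDr addnAC addnC => hk.
  apply: (IHk _ (ltnW kn)); apply: length_geS (hseq _ _ _ _ hk); last first.
    by move=> g t; apply: hE.
  by move=> y [hy|/hK]; [apply: sub_localspan; left; left|apply].
have [x nx _] : lg (Q `|` K 0%N) 1.
  by apply: (hn n) => //; apply: length_ge_le h; rewrite addn1.
apply: nx; rewrite -[x]mulr1; have [_ _ hM] := localspan_ideal (Q `|` K 0%N).
by apply: hM; apply: sub_localspan; right.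
Qed.

End Lengths.

(** * Artin-Rees and the growth of lengths *)

Section Adjoin.
Variable A : comPzRingType.
Implicit Types (B : set A) (y : A).

Lemma sub_adjoin B y : B `<=` adjoin B y.
Proof.
move=> x hx; exists 1%N, (fun _ => x); split=> //.
by rewrite big_ord1 expr0 mulr1.
Qed.

Lemma mem_adjoin B y : is_subring B -> adjoin B y y.
Proof.
move=> hB; exists 2%N, (fun i => (i == 1%N)%:R); split=> [i|].
  by case: eqP => _; [case: hB|apply: subring0].
by rewrite big_ord_recr big_ord1 /= mul0r mul1r add0r.
Qed.

Lemma adjoin_subring B y : is_subring B -> is_subring (adjoin B y).
Proof.
move=> hB; have [B1 BB BM] := hB; have B0 := subring0 hB.
have aD x z : adjoin B y x -> adjoin B y z -> adjoin B y (x + z).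
  move=> [n [b [hb ->]]] [m [c [hc ->]]].
  have pad k l (d : nat -> A) : \sum_(i < k) d i * y ^+ i =
      \sum_(i < k + l) (if (i < k)%N then d i else 0) * y ^+ i.
    rewrite big_split_ord /= [X in _ + X]big1 ?addr0 => [|i _].
      by apply: eq_bigr => i _; rewrite ltn_ord.
    by rewrite ltnNge leq_addr mul0r.
  exists (n + m)%N, (fun i => (if (i < n)%N then b i else 0) +
                              (if (i < m)%N then c i else 0)).
  split=> [i|]; first by apply: subringD => //; case: ifP.
  rewrite (pad n m) (pad m n) addnC -big_split /=.
  by apply: eq_bigr => i _; rewrite mulrDl.
have aM b x : B b -> adjoin B y x -> adjoin B y (b * x).
  move=> hb [n [c [hc ->]]]; exists n, (fun i => b * c i); split=> [i|].
    exact: BM.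
  by rewrite mulr_sumr; apply: eq_bigr => i _; rewrite mulrA.
have aX x : adjoin B y x -> adjoin B y (y * x).
  move=> [n [c [hc ->]]]; exists n.+1, (fun i => if i is j.+1 then c j else 0).
  split=> [[|i] //|]; rewrite big_ord_recl mul0r add0r mulr_sumr.
  by apply: eq_bigr => i _; rewrite exprS mulrCA.
have aN x : adjoin B y x -> adjoin B y (- x).
  by move=> hx; rewrite -mulN1r; apply: aM => //; apply: subringN.
split=> [|x z hx hz|x z [n [c [hc ->]]] hz]; first exact: sub_adjoin.
  by apply: aD => //; apply: aN.
rewrite mulr_suml; apply: big_ind => //; first exact: sub_adjoin.
move=> i _; rewrite -mulrA; apply: aM => //.
by elim: (nat_of_ord i) => [|k IHk]; rewrite ?mul1r // exprS -mulrA; apply: aX.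
Qed.

Lemma adjoin_min B B' y : is_subring B' -> B `<=` B' -> B' y ->
  adjoin B y `<=` B'.
Proof.
move=> hB' hBB hy x [n [b [hb ->]]]; apply: subring_sum => // i _.
by case: (hB') => _ _; apply; [apply: hBB|apply: subringX].
Qed.

Lemma noetherian_adjoin_seq B (ys : seq A) : is_subring B ->
  noetherian_sub B -> exists B', [/\ is_subring B', noetherian_sub B',
    B `<=` B', [set` ys] `<=` B' &
    forall C, is_subring C -> B `<=` C -> [set` ys] `<=` C -> B' `<=` C].
Proof.
move=> hB nB; elim: ys => [|y ys [B' [hB' nB' BB' hys hmin]]].
  by exists B; split.
exists (adjoin B' y); split.
- exact: adjoin_subring.
- exact: hilbert_basis.
- exact: subset_trans BB' (@sub_adjoin _ _).
- move=> z /=; rewrite inE => /orP[/eqP->|hz]; first exact: mem_adjoin.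
  by apply: sub_adjoin; apply: hys.
- move=> C hC BC ysC; apply: adjoin_min => //; last first.
    by apply: ysC; rewrite /= mem_head.
  by apply: hmin => // z hz; apply: ysC; rewrite /= inE hz orbT.
Qed.

End Adjoin.

Lemma noetherian_range (R A : comPzRingType) (f : {rmorphism R -> A}) :
  noeth R -> is_subring (range f) /\ noetherian_sub (range f).
Proof.
move=> hR; split.
  split=> [|_ _ [x _ <-] [y _ <-]|_ _ [x _ <-] [y _ <-]].
  - by exists 1; rewrite ?rmorph1.
  - by exists (x - y); rewrite ?rmorphB.
  - by exists (x * y); rewrite ?rmorphM.
move=> I hI [I0 ID IM]; have [//||G hG hG'] := hR [set x | I (f x)].
  split=> [|x y hx hy|a x _ hx] /=; first by rewrite rmorph0.
    by rewrite rmorphD; apply: ID.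
  by rewrite rmorphM; apply: IM => //; exists a.
exists (map f G) => [_ /= /mapP[x hx ->]|z Iz]; first exact: hG.
have [x _ xz] := hI _ Iz; rewrite -xz in Iz *.
have [h0 hD hM] := span_over_submodule (range f) [set` map f G].
apply: (span_over_min (I := [set x | span_over (range f) [set` map f G] (f x)])
         _ _ (hG' _ Iz)).
  split=> [|u v hu hv|a u _ hu] /=; first by rewrite rmorph0.
    by rewrite rmorphD; apply: hD.
  by rewrite rmorphM; apply: hM => //; exists a.
by move=> g hg; apply: sub_span_over; rewrite /= map_f.
Qed.

Section ArtinRees.
Variable R : comNzRingType.
Hypothesis hR : noeth R.
Implicit Types (I J P p : set R).

Lemma span_setU I J x : is_ideal I -> is_ideal J -> span (I `|` J) x ->
  exists2 y, J y & I (x - y).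
Proof.
move=> [I0 ID IM] [J0 JD JM].
apply: (@span_min _ _ [set x | exists2 y, J y & I (x - y)]).
  split=> [|x1 x2 [y1 J1 I1] [y2 J2 I2]|a x1 [y1 J1 I1]].
  - by exists 0; rewrite ?subr0.
  - exists (y1 + y2); first exact: JD.
    by rewrite opprD addrACA; apply: ID.
  - by exists (a * y1); [apply: JM|rewrite -mulrBr; apply: IM].
by move=> z [hz|hz]; [exists 0; rewrite ?subr0|exists z; rewrite ?subrr].
Qed.

(* B is the Rees algebra of p, generated over R by the g 'X with g in p. *)
Lemma rees_noetherian p : is_ideal p -> exists B : set {poly R},
  [/\ is_subring B, noetherian_sub B,
      forall F n, B F -> ipow p n F`_n &
      forall z n, ipow p n z -> B (z *: 'X^n)].
Proof.
move=> hp; have [//||gs hgs hgs'] := hR (I := p).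
  by rewrite -is_idealE.
have [sC nC] := noetherian_range (polyC : {rmorphism R -> {poly R}}) hR.
have [B [hB nB CB gB hmin]] :=
  noetherian_adjoin_seq [seq g *: 'X | g <- gs] sC nC.
have [B1 BB BM] := hB.
have BC c : B c%:P by apply: CB; exists c.
have BD F G : B F -> B G -> B (F + G) by apply: subringD.
exists B; split=> // [F n hF|z n].
  apply: (hmin [set F : {poly R} | forall n, ipow p n F`_n]) (hF) n.
  - split=> [n|F1 F2 h1 h2 n|F1 F2 h1 h2 n] /=.
    + rewrite coef1; case: n => [|n]; first by [].
      by case: (ipow_ideal p n.+1).
    + by rewrite coefB; apply: idealB => //; apply: ipow_ideal.
    + rewrite coefM; apply: ideal_sum => [|i]; first exact: ipow_ideal.
      by have := mem_ipowD (h1 i) (h2 (n - i)%N); rewrite subnKC // -ltnS.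
  - move=> _ [c _ <-] [|n] /=; first by [].
    by rewrite coefC; case: (ipow_ideal p n.+1).
  - move=> _ /= /mapP[g hg ->] n; rewrite coefZ coefX.
    case: eqP => [->|_].
      by rewrite mulr1; apply: ipow1; apply: hgs.
    by rewrite mulr0; case: (ipow_ideal p n).
have pX x : p x -> B (x *: 'X).
  move=> /hgs'.
  apply: (span_over_min (I := [set x | B (x *: 'X)])).
    split=> [|u v hu hv|a u _ hu] /=; first by rewrite scale0r -polyC0.
      by rewrite scalerDl; apply: BD.
    by rewrite -scalerA -mul_polyC; apply: BM.
  by move=> g hg; apply: gB; rewrite /= (map_f (fun g => g *: 'X)).
elim: n z => [|n IHn] z /=; first by rewrite expr0 alg_polyC.
apply: (@imul_min _ _ _ [set z | B (z *: 'X^(n.+1))]).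
  split=> [|u v hu hv|a u hu] /=; first by rewrite scale0r -polyC0.
    by rewrite scalerDl; apply: BD.
  by rewrite -scalerA -mul_polyC; apply: BM.
move=> x y hx hy /=.
have -> : (x * y) *: 'X^(n.+1) = (x *: 'X) * (y *: 'X^n) :> {poly R}.
  by rewrite -scalerAl -scalerAr scalerA exprS.
by apply: BM; [apply: pX|apply: IHn].
Qed.

(** The elements of the Rees algebra with coefficients in P + (x) form a finitely generated ideal,
    and k bounds the sizes of its generators. Hence P + (x) meets p^(n + k) inside P + p^n x, and x
    cancels modulo P. *)
Lemma artin_rees P p x : is_prime_ideal P -> is_ideal p -> ~ P x ->
  exists k, forall n r, span (P `|` ipow p (n + k)) (r * x) ->
    span (P `|` ipow p n) r.
Proof.
move=> [hP P1 hPM] hp nPx; have [P0 PD PM] := hP.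
have [B [hB nB Bp pB]] := rees_noetherian hp.
have [J0 JD JM] := span_ideal (P `|` [set x]).
have [|| Fs hFs hFs'] := nB [set F | B F /\ forall i, span (P `|` [set x]) F`_i].
- by move=> F [].
- split=> [|F G [BF hF] [BG hG]|F G BF [BG hG]] /=.
  + by split=> [|i]; [exact: (subring0 hB)|rewrite coef0].
  + split=> [|i]; first exact: (subringD hB).
    by rewrite coefD; apply: JD.
  + split=> [|i]; first by case: hB => _ _; apply.
    rewrite coefM; apply: (@ideal_sum _ (span _)) => [|j]; first exact: span_ideal.
    exact: JM.
pose k := (\max_(F <- Fs) size F)%N; exists k => n r hr.
have [z hz Pz] := span_setU hP (ipow_ideal p _) hr.
(* The generators satisfy this: up to degree k the truncated subtraction makes the power p^0, the
   whole ring, and beyond k their coefficients vanish. *)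
pose T := [set F : {poly R} | forall m, exists2 y,
  ipow p (m - k) y & P (F`_m - y * x)].
have hT : T (z *: 'X^(n + k)).
  have hBz : B (z *: 'X^(n + k)) by apply: pB.
  apply: (span_over_min (I := T)) (hFs' _ _).
  - split=> [m|F G hF hG m|F G BF hG m] /=.
    + exists 0; first by case: (ipow_ideal p (m - k)).
      by rewrite coef0 mul0r subrr.
    + have [y hy h] := hF m; have [y' hy' h'] := hG m.
      exists (y + y'); first by case: (ipow_ideal p (m - k)) => _ hD _; apply: hD.
      have -> : (F + G)`_m - (y + y') * x = F`_m - y * x + (G`_m - y' * x).
        by rewrite coefD; ring.
      exact: PD.
    + have /choice[y hy] : forall j, exists y,
          ipow p (j - k) y /\ P (G`_j - y * x).
        by move=> j; have [y h1 h2] := hG j; exists y.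
      exists (\sum_(i < m.+1) F`_i * y (m - i)%N).
        apply: ideal_sum => [|i]; first exact: ipow_ideal.
        have [h1 _] := hy (m - i)%N.
        have h : (m - k <= i + (m - i - k))%N by lia.
        by apply: (ipow_le hp h); apply: mem_ipowD => //; apply: Bp.
      rewrite coefM mulr_suml -sumrB; apply: ideal_sum => // i.
      rewrite -mulrA -mulrBr; apply: PM.
      by have [_] := hy (m - i)%N.
  - move=> F hF m; have [BF hJ] := hFs _ hF.
    have [mk|km] := leqP m k.
      have [y hy] := span_set1 hP (hJ m); exists y => //.
      by move: mk; rewrite -subn_eq0 => /eqP->.
    exists 0; first by case: (ipow_ideal p (m - k)).
    rewrite mul0r subr0 nth_default //; apply: leq_trans (ltnW km).
    exact: (@leq_bigmax_seq _ _ xpredT (fun F : {poly R} => size F)).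
  - split=> // i; rewrite coefZ coefXn.
    case: eqP => [_|_]; last by rewrite mulr0.
    rewrite mulr1 -[z](subrK (r * x)); apply: JD; last first.
      by apply: JM; apply: sub_span; right.
    by apply: sub_span; left; rewrite -opprB -mulN1r; apply: PM.
have [y] := hT (n + k)%N; rewrite addnK coefZ coefXn eqxx mulr1 => hy hzy.
have /hPM[h|//] : P ((r - y) * x).
  have -> : (r - y) * x = (r * x - z) + (z - y * x) by ring.
  exact: PD.
rewrite -[r](subrK y); have [_ hD _] := span_ideal (P `|` ipow p n).
by apply: hD; apply: sub_span; [left|right].
Qed.

(* Multiplication by an element x of P 1 outside P 0 embeds R / (P 0 : x), which
   is R / P 0, in R / P 0 with cokernel R / (P 0 + (x)), hence by Artin-Rees the
   lengths at s + 1 grow at least like the sums of the lengths at s. *)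
Lemma length_prime_chain s (P : nat -> set R) : is_prime_chain s P ->
  exists2 c, (0 < c)%N & forall n, (0 < n)%N ->
    length_ge (P s) (P 0%N `|` ipow (P s) (c * n)) (n ^ s).
Proof.
elim: s P => [|s IHs] P hP.
  exists 1%N => // n hn; rewrite expn0; have hq := hP.1 0%N (leqnn _).
  have [hqi q1 qM] := hq.
  have hn' : ipow (P 0%N) (1 * n) `<=` P 0%N.
    by rewrite mul1n; case: n hn => // n _; apply: ipowS_sub.
  exists 1 => // -[u nu]; rewrite mulr1 => hu; apply: nu.
  by apply: (span_min hqi _ hu) => z [//|/hn'].
have [|c c0 hc] := IHs (fun i => P i.+1).
  by split=> i hi; [apply: hP.1|apply: hP.2].
have hq := hP.1 s.+1 (leqnn _); have h0 := hP.1 0%N (leq0n _).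
have [h01 /existsNP[x /not_implyP[P1x nP0x]]] := hP.2 0%N (ltn0Sn s).
have hqi : is_ideal (P s.+1) by case: hq.
have [k hk] := artin_rees h0 hqi nP0x.
exists (c + k)%N; first by rewrite addn_gt0 c0.
move=> n hn.
(* Each multiplication by x adds n^s to the length and costs k in the exponent. At j = n the
   exponent is (c + k) n. *)
suff h j : length_ge (P s.+1) (P 0%N `|` ipow (P s.+1) (c * n + j * k))
     (j * n ^ s).
  by have := h n; rewrite expnS mulnDl [(k * n)%N]mulnC.
elim: j => [|j IHj]; first by [].
have -> : (j.+1 * n ^ s = j * n ^ s + n ^ s)%N by rewrite mulSn addnC.
apply: (length_ge_colon (x := x) hq _ _ IHj) => [r [u nu]|]; last first.
  apply: (length_geS hq _ (hc n hn)) => z hz; apply: sub_localspan => //.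
  case: hz => [[hz|hz]|->]; [by left; apply: h01| |by left].
  right; apply: ipow_le hz => //; exact: leq_addr.
rewrite mulrA => hu; exists u => //; apply: hk.
by move: hu; rewrite mulSn [(k + _)%N]addnC addnA.
Qed.

End ArtinRees.

(** * Heights and the principal ideal theorem *)

Section Heights.
Variable R : comNzRingType.
Hypothesis hR : noeth R.
Implicit Types (I J P Q p q : set R).

Lemma minimal_prime_localspan G q : minimal_prime (span G) q ->
  exists e, ipow q e `<=` localspan q G.
Proof.
move=> /(minimal_prime_pow hR (span_ideal G))[e [u [nu hu]]].
by exists e => x hx; exists u => //; apply: hu.
Qed.

(** Otherwise the length modulo Q and p^(cn) would be at least n^2, whereas the filtration by powers
    of y, whose layers are cyclic and killed by Q and y, bounds it by l c n. *)
Lemma krull_principal_ideal Q Q' p y : is_prime_ideal Q -> is_prime_ideal Q' ->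
  Q `<` Q' -> Q' `<` p -> ~ minimal_prime (span (Q `|` [set y])) p.
Proof.
move=> hQ hQ' QQ' Q'p hmin; have [hp Ip _] := hmin.
have [e he] := minimal_prime_localspan hmin.
have [l hl] := length_ge_filtration hp Q hR he.
have [|c c0 hc] := @length_prime_chain _ hR 2 (nth p [:: Q; Q']).
  by split=> [[|[|[|i]]]|[|[|i]]].
have py : p y by apply: Ip; apply: sub_span; right.
have hpi : is_ideal p by case: hp.
pose K j := [set z | exists2 k, (j <= k)%N & z = y ^+ k].
have yk k : ipow p k (y ^+ k).
  by elim: k => [|k IHk] //; rewrite exprS; apply: mem_imul.
have [n n0 hn] : exists2 n, (0 < n)%N & (l * (c * n) < n ^ 2)%N.
  by exists (l * c).+1 => //; rewrite mulnA; nia.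
have := hl K (fun j => [:: y ^+ j]) (c * n)%N (n ^ 2)%N.
have -> : (\sum_(j < c * n) size [:: y ^+ j] = c * n)%N.
  by rewrite -[RHS]card_ord -sum1_card.
rewrite leqNgt hn => hf; apply: notF; apply: hf.
- by exists 0%N.
- move=> j _ _ [k jk ->]; apply: sub_localspan => //.
  move: jk; rewrite leq_eqVlt => /orP[/eqP->|jk]; first by right; rewrite /= inE.
  by left; right; exists k.
- move=> j g t _; rewrite inE => /eqP-> [ht|->].
    have [_ _ hM] := localspan_ideal hp (Q `|` K j.+1).
    by rewrite mulrC; apply: hM; apply: sub_localspan => //; left.
  by apply: sub_localspan => //; right; exists j.+1; rewrite // exprS.
- apply: (length_geS hp _ (hc n n0)) => z [hz|[k hk ->]].
    by apply: sub_localspan => //; left.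
  by apply: sub_localspan => //; right; apply: (ipow_le hpi hk).
Qed.

Definition height_ge q n := exists2 P, is_prime_chain n P & P n = q.

Lemma height_ge_ltS P Q n : is_prime_ideal Q -> P `<` Q -> height_ge P n ->
  height_ge Q n.+1.
Proof.
move=> hQ PQ [C [hC hC'] Cn]; exists (fun i => if (i <= n)%N then C i else Q).
  split=> i; first by case: ifP => // h _; apply: hC.
  rewrite ltnS => h; rewrite h; case: ltnP => [h'|h']; first exact: hC'.
  by have -> : i = n by [apply/eqP; rewrite eqn_leq h]; rewrite Cn.
by rewrite ltnn.
Qed.

Lemma height_ge_sub P Q n : is_prime_ideal Q -> P `<=` Q -> height_ge P n ->
  height_ge Q n.
Proof.
move=> hQ PQ [C [hC hC'] Cn]; exists (fun i => if (i < n)%N then C i else Q).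
  split=> i; first by case: ifP => // h _; apply: hC; apply: ltnW.
  move=> h; rewrite h; case: ltnP => [h'|h']; first exact: hC'.
  have e : i.+1 = n by apply/eqP; rewrite eqn_leq h.
  have [CC nCC] := hC' i h; rewrite e Cn in CC nCC.
  split; first exact: subset_trans PQ.
  by move=> QC; apply: nCC; apply: subset_trans QC.
by rewrite ltnn.
Qed.

Lemma height_geS q n : height_ge q n.+1 -> height_ge q n.
Proof.
move=> [C [hC hC'] Cn]; exists (fun i => C i.+1) => //.
by split=> i hi; [apply: hC|apply: hC'].
Qed.

(** The new element b avoids those primes P of a cover of the previous ones that do not contain p. A
    prime over all the elements contains some P of the cover: if p is inside P it contains p, and
    otherwise the inclusion is strict because of b. *)
Lemma exists_parameters p n : is_prime_ideal p -> height_ge p n ->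
  exists2 a : nat -> R, (forall i, (i < n)%N -> p (a i)) &
    forall q, is_prime_ideal q -> (forall i, (i < n)%N -> q (a i)) ->
      height_ge q n.
Proof.
move=> hp; have hpi : is_ideal p by case: hp.
elim: n => [|n IHn] hpn.
  by exists (fun _ => 0) => // q hq _; exists (fun _ => q).
have [a pa ha] := IHn (height_geS hpn).
pose I := span [set a i | i in [set i | (i < n)%N]].
have [ps hps hI] := prime_cover hR (span_ideal [set a i | i in [set i | (i < n)%N]]).
have [|b pb hb] := @prime_avoidance _ p ps hpi; first by move=> P /hps[].
exists (fun i => if (i < n)%N then a i else b) => [i _|q hq hqa].
  by case: ifP => // /pa.
have qa i : (i < n)%N -> q (a i).
  by move=> h; have := hqa i (ltnW h); rewrite h.
have qb : q b by have := hqa n (ltnSn n); rewrite ltnn.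
have Iq : I `<=` q.
  by apply: span_min; [case: hq|move=> _ [i hi <-]; apply: qa].
have [P hP Pq] := iprod_sub_prime hq (subset_trans hI Iq).
have [pP|npP] := pselect (p `<=` P).
  by apply: height_ge_sub hpn => //; apply: subset_trans Pq.
have [hP' IP] := hps P hP.
apply: (@height_ge_ltS P) => //.
  by split=> // qP; apply: (hb P) => //; apply: qP.
by apply: ha => // i hi; apply: IP; apply: sub_span; exists i.
Qed.

(* In the local domain R_P / Q all nonzero ideals contain a power of t. If its
   maximal ideal were not minimal over t, an element y of it outside the minimal
   primes over t would be contained in a minimal prime p' over y with
   0 < (a minimal prime over t) < p', against the principal ideal theorem. *)
Lemma artin_tate Q P t : is_prime_ideal Q -> is_prime_ideal P -> Q `<=` P ->
  P t -> ~ Q t ->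
  (forall J, is_ideal J -> Q `<=` J -> ~ J `<=` Q ->
     exists n v, ~ P v /\ J (t ^+ n * v)) ->
  exists e, ipow P e `<=` localspan P (Q `|` [set t]).
Proof.
move=> hQ hP QP Pt nQt hJ.
suff : minimal_prime (span (Q `|` [set t])) P by apply: minimal_prime_localspan.
have hPi : is_ideal P by case: hP.
split=> //.
  by apply: span_min => // z [/QP|->].
move=> Q' hQ' IQ' Q'P; apply: contrapT => nPQ'.
have [ps hps hI] := prime_cover hR (span_ideal (Q `|` [set t])).
have [|y Py hy] := @prime_avoidance _ P ps hPi; first by move=> p /hps[].
have strict p : is_prime_ideal p -> span (Q `|` [set t]) `<=` p -> Q `<` p.
  move=> hp Ip; split.
    by move=> z Qz; apply: Ip; apply: sub_span; left.
  by move=> pQ; apply: nQt; apply: pQ; apply: Ip; apply: sub_span; right.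
have [p0 hp0 p0Q'] := iprod_sub_prime hQ' (subset_trans hI IQ').
have np0y : ~ p0 y.
  by apply: hy => // Pp0; apply: nPQ'; apply: subset_trans p0Q'.
have nQy : ~ Q y.
  move=> Qy; apply: np0y; have [_ Ip0] := hps p0 hp0.
  by apply: Ip0; apply: sub_span; left.
have [|||p' hp' p'P] := @exists_minimal_prime _ (span (Q `|` [set y])) P hR.
- exact: span_ideal.
- exact: hP.
- by apply: span_min => // z [/QP|->].
have [hpp Ip' _] := hp'; have [_ p'1 p'M] := hpp.
have Qp' : Q `<=` p' by move=> z Qz; apply: Ip'; apply: sub_span; left.
have p't : p' t.
  have [||n [v [nPv hv]]] := hJ p' _ Qp'; first by case: hpp.
    by move=> h; apply: nQy; apply: h; apply: Ip'; apply: sub_span; right.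
  case/p'M: hv => [|/p'P//]; elim: n => [|n IHn]; first by rewrite expr0.
  by rewrite exprS => /p'M[].
have Itp' : span (Q `|` [set t]) `<=` p'.
  by apply: span_min; [case: hpp|move=> z [/Qp'|->]].
have [pj hpj pjp'] := iprod_sub_prime hpp (subset_trans hI Itp').
have [hpjp Ipj] := hps pj hpj.
(* If P lies in pj, then p' is all of P and Q < Q' < p'. Otherwise y lies in p' but not in pj, and Q
   < pj < p'. *)
have [Ppj|nPpj] := pselect (P `<=` pj).
  apply: (krull_principal_ideal hQ hQ' (strict _ hQ' IQ') _ hp').
  split; first by apply: subset_trans pjp'; apply: subset_trans Ppj.
  by move=> p'Q'; apply: nPQ'; apply: subset_trans p'Q'; apply: subset_trans pjp'.
apply: (krull_principal_ideal hQ hpjp (strict _ hpjp Ipj) _ hp').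
split=> // p'pj; apply: (hy pj) => //; apply: p'pj; apply: Ip'.
by apply: sub_span; right.
Qed.

End Heights.

(** * Monomials and the upper bound on lengths *)

Section Monomials.
Variables (R : comNzRingType) (I : finType).
Implicit Types (a : I -> R) (w : I -> nat) (m : I -> nat).

Definition monomial a m : R := \prod_i a i ^+ m i.

Definition weight w m : nat := (\sum_i m i * w i)%N.

Lemma monomialD a m m' :
  monomial a (fun i => m i + m' i)%N = monomial a m * monomial a m'.
Proof. by rewrite -big_split; apply: eq_bigr => i _; rewrite exprD. Qed.

Lemma monomial0 a : monomial a (fun _ => 0%N) = 1.
Proof. by rewrite /monomial big1 // => i _; rewrite expr0. Qed.

Lemma monomial1 a i : monomial a (fun j => (j == i) : nat) = a i.
Proof.
rewrite /monomial (bigD1 i) //= eqxx expr1 big1 ?mulr1 // => j /negbTE->.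
by rewrite expr0.
Qed.

Lemma weightD w m m' :
  weight w (fun i => m i + m' i)%N = (weight w m + weight w m')%N.
Proof. by rewrite -big_split; apply: eq_bigr => i _; rewrite mulnDl. Qed.

Lemma weight0 w : weight w (fun _ => 0%N) = 0%N.
Proof. by rewrite /weight big1. Qed.

Lemma weight1 w i : weight w (fun j => (j == i) : nat) = w i.
Proof.
by rewrite /weight (bigD1 i) //= eqxx mul1n big1 ?addn0 // => j /negbTE->.
Qed.

Lemma leq_weight w m i : (0 < w i)%N -> (m i <= weight w m)%N.
Proof.
move=> wi; rewrite /weight (bigD1 i) //=; apply: leq_trans (leq_addr _ _).
exact: leq_pmulr.
Qed.

(** Kronecker substitution: the weights are successive powers of N, and exponents below N are the
    digits of the total weight. *)
Lemma kronecker_weight N : exists v : I -> nat, forall m m',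
  (forall i, m i < N)%N -> (forall i, m' i < N)%N ->
  weight v m = weight v m' -> m =1 m'.
Proof.
suff [v hv] : exists v : I -> nat, forall m m',
    (forall i, m i < N)%N -> (forall i, m' i < N)%N ->
    (\sum_(i <- enum I) m i * v i = \sum_(i <- enum I) m' i * v i)%N ->
    forall i, i \in enum I -> m i = m' i.
  exists v => m m' hm hm'; rewrite /weight -!big_enum => /hv h i.
  by apply: h => //; rewrite mem_enum.
elim: (enum I) (enum_uniq I) => [_|i0 r IHr /=]; first by exists (fun _ => 0%N).
move=> /andP[i0r /IHr[v hv]].
exists (fun i => if i == i0 then 1%N else (N * v i)%N) => m m' hm hm'.
have E k : (\sum_(j <- r) k j * (if j == i0 then 1 else N * v j) =
    (\sum_(j <- r) k j * v j) * N)%N.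
  rewrite big_distrl /= big_seq [RHS]big_seq; apply: eq_bigr => j jr.
  case: eqP jr i0r => [->->//|_ _ _]; by rewrite -mulnA [(v j * N)%N]mulnC.
rewrite !big_cons eqxx !muln1 !E => h.
have e0 : m i0 = m' i0.
  have := congr1 (modn^~ N) h; rewrite /= ![(_ + _ * N)%N]addnC !modnMDl.
  by rewrite !modn_small.
move=> i; rewrite inE => /orP[/eqP->//|]; apply: hv => //.
move: h; rewrite e0 => /addnI /eqP; rewrite eqn_pmul2r; first by move/eqP.
by apply: leq_ltn_trans (hm i0).
Qed.

(** Stands in for a monomial order on finitely many monomials: it is additive and has no ties. *)
Lemma separating_weight (ms : seq {cmonom I}) :
  exists v : I -> nat, {in ms &, injective (fun m : {cmonom I} => weight v m)}.
Proof.
pose N := (\max_(m <- ms) \max_i m i).+1.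
have hN (m : {cmonom I}) i : m \in ms -> (m i < N)%N.
  move=> hm; rewrite ltnS; apply: (@leq_trans (\max_i m i)).
    exact: (leq_bigmax (F := m) i).
  exact: (@leq_bigmax_seq _ ms xpredT (fun m : {cmonom I} => \max_i m i)%N).
have [v hv] := kronecker_weight N; exists v => m m' hm hm' e.
by apply/eqP/cmP => i; apply: hv e i => i; apply: hN.
Qed.

Lemma mem_monomial_ipow q a m : is_ideal q -> (forall i, q (a i)) ->
  ipow q (\sum_i m i) (monomial a m).
Proof.
move=> hq ha; rewrite /monomial; apply: (big_ind2 (fun n x => ipow q n x)) => //.
  by move=> n x n' x' hn hn'; apply: mem_ipowD.
move=> i _; elim: (m i) => [|k IHk] //; rewrite exprS; exact: mem_imul.
Qed.

Definition monomials_ge a w j : set R :=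
  [set x | exists2 m, (j <= weight w m)%N & x = monomial a m].

Lemma monomials_ge_ipow q a w V n : is_ideal q -> (forall i, q (a i)) ->
  (forall i, w i <= V)%N -> (0 < V)%N ->
  monomials_ge a w (V * n) `<=` ipow q n.
Proof.
move=> hq ha hV V0 x [m hm ->].
apply: ipow_le (mem_monomial_ipow m hq ha) => //.
rewrite -(leq_pmul2l V0); apply: leq_trans hm _; rewrite big_distrr /=.
by apply: leq_sum => i _; rewrite mulnC leq_mul2r hV orbT.
Qed.

End Monomials.

Section Upper.
Variables (R : comNzRingType) (s : nat).
Hypothesis hR : noeth R.
Implicit Types (a : 'I_s -> R) (w : 'I_s -> nat) (Q q : set R).

Definition standard_monomials (std : ('I_s -> nat) -> bool) a w j : set R :=
  [set x | exists2 m, std m && (weight w m == j) & x = monomial a m].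

(** In the filtration by weight, multiplication by any a_i moves a monomial to a later layer because
    weights are positive. For the same reason monomials of weight less than n have exponents less
    than n, so a box bounds their number. *)
Lemma length_ge_monomials q Q a w e : is_prime_ideal q ->
  (forall i, 0 < w i)%N -> ipow q e `<=` localspan q (Q `|` range a) ->
  exists l, forall std n N,
    (forall m, (weight w m < n)%N ->
       localspan q (Q `|` monomials_ge a w (weight w m).+1 `|`
                    standard_monomials std a w (weight w m)) (monomial a m)) ->
    length_ge q (Q `|` monomials_ge a w n) N ->
    (N <= l * #|[pred f : {ffun 'I_s -> 'I_n} | std (fun i => f i : nat)]|)%N.
Proof.
move=> hq hw he; have [l hl] := length_ge_filtration hq Q hR he.
exists l => std n N hstd hN.
pose mon (f : {ffun 'I_s -> 'I_n}) := monomial a (fun i => f i : nat).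
pose wt (f : {ffun 'I_s -> 'I_n}) := weight w (fun i => f i : nat).
pose E j := [seq mon f | f in
  [pred f : {ffun 'I_s -> 'I_n} | std (fun i => f i : nat) && (wt f == j)]].
have {hl}/hl hl : monomials_ge a w 0 1.
  by exists (fun _ => 0%N); rewrite ?monomial0.
have {}hl := hl E n N.
apply: (leq_trans (hl _ _ hN)) => {hl}.
- move=> j jn _ [m jm ->]; move: jm; rewrite leq_eqVlt => /orP[/eqP ej|jm].
    rewrite ej in jn *; apply: (localspan_min hq _ (hstd m jn)) => z [[hz|hz]|].
    + by apply: sub_localspan => //; left; left.
    + by apply: sub_localspan => //; left; right.
    + move=> [m' /andP[sm' /eqP em'] ->]; apply: sub_localspan => //; right.
      have hm' i : (m' i < n)%N.
        by apply: leq_ltn_trans (leq_weight m' (hw i)) _; rewrite em'.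
      change (monomial a m' \in E (weight w m)).
      apply/mapP; exists [ffun i => Ordinal (hm' i)].
        rewrite mem_enum inE /wt.
        have -> : (fun i => [ffun i => Ordinal (hm' i)] i : nat) = m'.
          by apply/funext => i; rewrite ffunE.
        by rewrite sm' em' eqxx.
      by rewrite /mon; congr monomial; apply/funext => i; rewrite ffunE.
  by apply: sub_localspan => //; left; right; exists m.
- move=> j g t jn /mapP[f]; rewrite mem_enum inE => /andP[_ /eqP <-] -> [ht|[i _ <-]].
    have [_ _ hM] := localspan_ideal hq (Q `|` monomials_ge a w (wt f).+1).
    by rewrite mulrC; apply: hM; apply: sub_localspan => //; left.
  apply: sub_localspan => //; right.
  exists (fun j => (j == i) + f j)%N; last by rewrite monomialD monomial1.
  by rewrite weightD weight1 -[X in (X <= _)%N]add1n leq_add2r.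
rewrite leq_mul2l; apply/orP; right.
under eq_bigr => j _ do rewrite size_map -cardE -sum1_card.
rewrite (exchange_big_dep
  (fun f : {ffun 'I_s -> 'I_n} => std (fun i => f i : nat))) /=; last first.
  by move=> j f _; rewrite inE => /andP[].
rewrite -sum1_card; apply: leq_sum => f sf.
have [fn|fn] := ltnP (wt f) n; last first.
  rewrite big1 // => j; rewrite inE => /andP[_ /eqP ej].
  by move: (ltn_ord j); rewrite -ej ltnNge fn.
rewrite (bigD1 (Ordinal fn)) /=; last by rewrite inE sf eqxx.
rewrite big1 // => j; rewrite inE => /andP[/andP[_ /eqP ej]] /eqP[].
exact: val_inj.
Qed.

End Upper.

(** * Part (a) *)

Section Independent.
Variable s : nat.

(** Some coordinate i of f lies below [M i], which leaves at most [M i] values for it and n for each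
    of the s others. *)
Lemma card_not_above (M : 'I_s.+1 -> nat) n :
  (#|[pred f : {ffun 'I_s.+1 -> 'I_n} | ~~ [forall i, M i <= f i]]|
     <= (\sum_i M i) * n ^ s)%N.
Proof.
rewrite -sum1_card big_distrl /=.
pose A i := [pred f : {ffun 'I_s.+1 -> 'I_n} | (f i < M i)%N].
apply: (@leq_trans (\sum_i #|A i|)).
  under [leqRHS]eq_bigr => i _ do rewrite -sum1_card.
  rewrite (exchange_big_dep xpredT) //= big_mkcond; apply: leq_sum => f _.
  case: ifP => // /forallPn[i]; rewrite -ltnNge => hi.
  by rewrite (bigD1 i).
apply: leq_sum => i _.
pose F (j : 'I_s.+1) : pred 'I_n := fun x => (j == i) ==> (x < M i)%N.
have -> : #|A i| = #|(family F : pred {ffun 'I_s.+1 -> 'I_n})|.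
  apply: eq_card => f; rewrite inE; apply/idP/familyP => [fi j|/(_ i)].
    by rewrite unfold_in /F; apply/implyP => /eqP->.
  by rewrite unfold_in /F eqxx.
rewrite card_family foldrE big_map big_enum /= (bigD1 i) //=.
apply: leq_mul.
  rewrite cardE -(size_map val) -[leqRHS](size_iota 0).
  apply: uniq_leq_size => [|x /mapP[y]].
    by rewrite map_inj_uniq ?enum_uniq //; apply: val_inj.
  by rewrite mem_enum unfold_in /F eqxx mem_iota => /= hy ->.
rewrite (eq_bigr (fun _ => n)) => [|j ji].
  by rewrite prod_nat_const cardC1 card_ord.
rewrite -[RHS]card_ord; apply: eq_card => x.
by rewrite unfold_in /F (negbTE ji).
Qed.

Variable R : comNzRingType.
Implicit Types (a : 'I_s -> R) (Q q : set R).

(* Among the monomials of the initial form of f whose coefficient is not in q,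
   take M maximal for an injective auxiliary weight. Modulo q and modulo higher
   weights, f rewrites the multiples of M; as q is nilpotent modulo the a_i, the
   monomials that are not divisible by M span. *)
Lemma standard_monomials_span q Q a (w : 'I_s -> nat) e
    (f : polynomials R s) (M0 : {cmonom 'I_s}) :
  is_prime_ideal q -> (forall i, 0 < w i)%N ->
  ipow q e `<=` localspan q (Q `|` range a) -> peval f a = 0 ->
  M0 \in msupp f -> (forall m, m \in msupp f -> (weight w M0 <= weight w m)%N) ->
  ~ q f@_M0 ->
  exists M : {cmonom 'I_s}, forall m : 'I_s -> nat,
    localspan q (Q `|` monomials_ge a w (weight w m).+1 `|`
      standard_monomials (fun m => ~~ [forall i, M i <= m i]%N) a w (weight w m))
      (monomial a m).
Proof.
move=> hq hw he fa hM0 hmin nqM0; have hqi : is_ideal q by case: hq.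
have [v hv] := separating_weight (msupp f).
pose good (m : {cmonom 'I_s}) :=
  [&& m \in msupp f, weight w m == weight w M0 & ~~ `[< q f@_m >]].
have good0 : good M0 by rewrite /good hM0 eqxx; apply/asboolPn.
pose has_good k := has (fun m : {cmonom 'I_s} => good m && (weight v m == k)) (msupp f).
have ex0 : exists k, has_good k.
  by exists (weight v M0); apply/hasP; exists M0 => //; rewrite good0 eqxx.
have bnd k : has_good k ->
    (k <= \max_(m <- msupp f) weight v (m : {cmonom 'I_s}))%N.
  move=> /hasP[m hm /andP[_ /eqP<-]].
  exact: (@leq_bigmax_seq _ _ xpredT (fun m : {cmonom 'I_s} => weight v m) m hm isT).
have [k /hasP[M hM /andP[goodM /eqP Mk]] kmax] := ex_maxnP ex0 bnd.
have Mmax m : good m -> m != M -> (weight v m < weight v M)%N.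
  move=> gm nmM; have hm : m \in msupp f by case/and3P: gm.
  rewrite ltn_neqAle Mk kmax ?andbT; last first.
    by apply/hasP; exists m => //; rewrite gm eqxx.
  by rewrite -Mk; apply: contra nmM => /eqP /hv ->.
have {goodM} /and3P[_ /eqP wM /asboolPn nqM] := goodM.
exists M => m0; set j := weight w m0.
set Z := (X in localspan q X).
have hZ := localspan_ideal hq Z; have [Z0 ZD ZM] := hZ.
(* Descending induction on i, starting at e, where t falls locally into the ideal of [Q] and the
   a_i; for fixed i, induction on the auxiliary weight v of m. *)
suff H i t m : ipow q i t -> weight w m = j -> localspan q Z (t * monomial a m).
  by have := H 0%N 1 m0 I erefl; rewrite mul1r.
have above m' t' : (j < weight w m')%N -> localspan q Z (t' * monomial a m').
  move=> hm; apply: ZM; apply: sub_localspan => //; left; right.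
  by exists m'.
have H0 t' m' : ipow q e t' -> weight w m' = j ->
    localspan q Z (t' * monomial a m').
  move=> /he[u nu hu] hm; apply: (localspan_cancel hq nu); rewrite mulrA.
  apply: (@span_min _ _ [set t | localspan q Z (t * monomial a m')] _ _ _ hu).
    split=> [|x y hx hy|b x hx] /=; first by rewrite mul0r.
      by rewrite mulrDl; apply: ZD.
    by rewrite -mulrA; apply: ZM.
  move=> x [Qx|[l _ <-]] /=.
    by rewrite mulrC; apply: ZM; apply: sub_localspan => //; left; left.
  rewrite -[a l](monomial1 a) -monomialD -[monomial _ _]mul1r; apply: above.
  by rewrite weightD weight1 hm -[X in (X < _)%N]add0n ltn_add2r.
suff H1 k' : (forall t m, ipow q k'.+1 t -> weight w m = j ->
     localspan q Z (t * monomial a m)) ->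
   forall t m, ipow q k' t -> weight w m = j -> localspan q Z (t * monomial a m).
  have {}H1 k' t' m' : (k' <= e)%N -> ipow q (e - k')%N t' ->
      weight w m' = j -> localspan q Z (t' * monomial a m').
    elim: k' t' m' => [|k' IHk] t' m' hk; first by rewrite subn0; apply: H0.
    apply: H1 => t'' m''; rewrite -subSn // subSS; apply: IHk; exact: ltnW.
  have [ie|ei] := leqP i e.
    by move=> ht; apply: (H1 (e - i)%N); rewrite ?leq_subr // subKn.
  by move=> ht; apply: H0; apply: ipow_le ht => //; apply: ltnW.
move=> IHk {}t {}m ht; have [n] := ubnP (weight v m).
elim: n m => // n IHn m hn hm.
have [std|] := boolP (~~ [forall i, M i <= m i]%N).
  apply: ZM; apply: sub_localspan => //; right.
  by exists m; rewrite // std hm /=.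
rewrite negbK => /forallP Mm.
pose m' i := (m i - M i)%N.
have mE : m = (fun i => M i + m' i)%N by apply/funext => l; rewrite subnKC.
have E : f@_M * (t * monomial a m) = - \sum_(mu <- rem M (msupp f))
    f@_mu * t * monomial a (fun i => mu i + m' i)%N.
  have : \sum_(mu <- msupp f) f@_mu * t * monomial a (fun i => mu i + m' i)%N = 0.
    under eq_bigr => mu _ do rewrite monomialD mulrA.
    rewrite -mulr_suml; under eq_bigr => mu _ do rewrite mulrAC.
    by rewrite -mulr_suml -[\sum_(_ <- _) _]/(peval f a) fa !mul0r.
  rewrite (big_rem M) //= -mE => /eqP; rewrite addr_eq0 => /eqP<-.
  by rewrite mulrA.
apply: (localspan_cancel hq nqM); rewrite E -mulN1r; apply: ZM.
rewrite big_seq; apply: big_ind => // mu.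
rewrite (rem_filter _ (fset_uniq _)) mem_filter /= => /andP[nmuM hmu].
(* Each other term of f falls under one of three cases: larger weight, hence a later layer;
   coefficient in q, hence a higher power of q; or, by the choice of M, smaller auxiliary weight. *)
have := hmin _ hmu; rewrite leq_eqVlt => /orP[/eqP emu|lmu]; last first.
  apply: above; rewrite weightD -hm mE weightD ltn_add2r.
  by rewrite wM.
have ew : weight w (fun i => mu i + m' i)%N = j.
  by rewrite weightD -emu -wM -weightD -mE.
have [qmu|nqmu] := pselect (q f@_mu).
  by apply: IHk => //; apply: mem_imul.
rewrite -mulrA; have [_ _ ZM] := hZ; apply: ZM; apply: IHn => //.
have gmu : good mu by rewrite /good hmu -emu eqxx; apply/asboolPn.
rewrite ltnS in hn; apply: leq_trans hn.
rewrite mE !weightD -addSn leq_add2r.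
exact: Mmax.
Qed.

End Independent.

Lemma not_linear_bound C k : ~ (forall n, (0 < n)%N -> (n ^ k.+1 <= C * n ^ k)%N).
Proof.
move=> /(_ C.+1 isT); rewrite expnS leq_pmul2r ?ltnn //.
by rewrite expn_gt0.
Qed.

Lemma initial_form_coef (R : comPzRingType) s (w : nat -> nat)
    (f : polynomials R s) m : (initial_form w f)@_m != 0 ->
  [/\ m \in msupp f, (initial_form w f)@_m = f@_m &
      forall m', m' \in msupp f -> (wdeg w m <= wdeg w m')%N].
Proof.
rewrite /initial_form mcoeffE; case: ifP => [mf|]; last by rewrite eqxx.
by case: ifP => [/allP h _|]; [split|rewrite eqxx].
Qed.

(** The a_i are chosen only for the heights of the primes over them, hence before w; the weights and
    the relation enter the constants alone. *)
Lemma exists_weighted_independent (R : comNzRingType) s (P : nat -> set R) :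
  noeth R -> is_prime_chain s.+1 P ->
  exists a : 'I_s.+1 -> R,
    forall w, weight_sequence w -> weighted_independent w a.
Proof.
move=> hR hP; have hp := hP.1 s.+1 (leqnn _).
have [a0 pa0 ha0] := exists_parameters hR hp (ex_intro2 _ _ P hP erefl).
pose a (i : 'I_s.+1) := a0 i.
exists a => w hw [f [fa [M0 [v hv]]]].
have [|q hmin qp] := exists_minimal_prime hR (span_ideal (range a)) hp.
  by apply: span_min => [|_ [i _ <-]]; [case: hp|apply: pa0].
have [hq Iq _] := hmin; have [hqi q1 qM] := hq.
have qa i : q (a i) by apply: Iq; apply: sub_span; exists i.
have [|C hC Cq] := ha0 q hq.
  by move=> i hi; apply: (qa (Ordinal hi)).
have [c c0 hc] := length_prime_chain hR hC; rewrite Cq in hc.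
have [e he] := minimal_prime_localspan hR hmin.
pose Q := C 0%N.
have {}he : ipow q e `<=` localspan q (Q `|` range a).
  by apply: subset_trans he _; apply: localspanS => // z; right.
have hw' (i : 'I_s.+1) : (0 < w i)%N by apply: hw.
have hv0 : (initial_form w f)@_M0 != 0.
  by apply/eqP => h; move: hv; rewrite h mul0r => /esym/eqP; rewrite oner_eq0.
have [M0f fM0 M0min] := initial_form_coef hv0.
have [|M hM] := standard_monomials_span (w := fun i => w i) hq hw' he fa M0f M0min.
  by rewrite -fM0 => h; apply: q1; rewrite -hv; apply: idealMr.
have [l hl] := length_ge_monomials hR (Q := Q) hq hw' he.
(* A positive bound on the weights: monomials of weight at least V c n have total degree at least c
   n, hence lie in q^(cn). *)
pose V := (\sum_(i < s.+1) w i).+1.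
have hV (i : 'I_s.+1) : (w i <= V)%N.
  by rewrite /V (bigD1 i) //= -addnS leq_addr.
apply: (@not_linear_bound (l * ((\sum_i M i) * (V * c) ^ s))%N s) => n n0.
have := hl _ (V * (c * n))%N (n ^ s.+1)%N (fun m _ => hM m).
move=> /(_ _)/leq_trans; apply.
  apply: (length_geS hq _ (hc n n0)) => z [hz|/(monomials_ge_ipow hqi qa hV isT) hz].
    by apply: sub_localspan => //; left.
  by apply: sub_localspan => //; right.
rewrite -mulnA leq_mul2l; apply/orP; right.
by apply: leq_trans (card_not_above _ _) _; rewrite -mulnA -expnMn -mulnA.
Qed.

(** * Polynomial rings *)

Section MonoidAlgebra.
Variables (R : comNzRingType) (I : finType).
Local Notation K := {cmonom I}.
Local Notation S := {malg R[K]}.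
Implicit Types (F G : S) (m : I -> nat) (k : K).

Definition cmon m : K := [cmonom m i | i in [fset i in enum I]%fset]%M.

Lemma cmonE m i : cmon m i = m i.
Proof. by rewrite cmE fsfun_fun inE mem_enum. Qed.

Lemma cmonK k : cmon k = k.
Proof. by apply/eqP/cmP => i; rewrite cmonE. Qed.

Lemma malgUM c d k k' :
  << c *g k >> * << d *g k' >> = << c * d *g mmul k k' >> :> S.
Proof. exact: fgmulUU. Qed.

Lemma malg_ind (Pr : S -> Prop) : (forall F G, Pr F -> Pr G -> Pr (F + G)) ->
  (forall c k, Pr << c *g k >>) -> forall F, Pr F.
Proof.
move=> hD hU F; rewrite [F]monalgE; apply: big_ind => //.
by have := hU 0 (@mone K); rewrite monalgU0.
Qed.

Lemma malgU_ext k k' : (forall i, k i = k' i) -> << k >> = << k' >> :> S.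
Proof. by move=> h; have /eqP-> : k == k' by apply/cmP. Qed.

Definition mvar i : S := << @ucm I i >>.

Lemma monomial_mvar m : monomial mvar m = << cmon m >>.
Proof.
have hX i n : mvar i ^+ n = << cmon (fun j => if j == i then n else 0)%N >>.
  elim: n => [|n IHn].
    transitivity (<< @mone K >> : S); first by rewrite expr0.
    by apply: malgU_ext => j; rewrite cm1 cmonE if_same.
  rewrite exprS IHn malgUM mulr1; apply: malgU_ext => j.
  rewrite cmM cmU !cmonE [i == j]eq_sym.
  by case: eqP.
have h (r : seq I) : uniq r -> \prod_(i <- r) mvar i ^+ m i =
    << cmon (fun j => if j \in r then m j else 0)%N >>.
  elim: r => [_|i r IHr /= /andP[ir /IHr{}IHr]].
    transitivity (<< @mone K >> : S); first by rewrite big_nil.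
    by apply: malgU_ext => j; rewrite cm1 cmonE.
  rewrite big_cons IHr hX malgUM mulr1; apply: malgU_ext => j.
  rewrite cmM !cmonE inE.
  by case: eqP => [->|//]; rewrite (negbTE ir) addn0.
transitivity (\prod_(i <- enum I) mvar i ^+ m i); first by rewrite big_enum.
rewrite (h _ (enum_uniq I)); apply: malgU_ext => j.
by rewrite !cmonE mem_enum.
Qed.

Lemma malgU_mvar c k : << c *g k >> = c%:MP * monomial mvar k :> S.
Proof. by rewrite monomial_mvar cmonK malgUM mulr1 mul1m. Qed.

Lemma noeth_malg : noeth R -> noeth S.
Proof.
move=> hR.
have [sC nC] := noetherian_range (@malgC K R : {rmorphism R -> S}) hR.
have [B [hB nB CB vB _]] := noetherian_adjoin_seq [seq mvar i | i <- enum I] sC nC.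
have [B1 BB BM] := hB.
suff E : B = [set: S] by move: nB; rewrite E.
apply/seteqP; split=> // F _; elim/malg_ind: F => [F G|c k].
  exact: subringD.
rewrite malgU_mvar; apply: (BM); first by apply: CB; exists c.
rewrite /monomial; apply: (big_ind B) => [//|x y|i _]; first exact: BM.
apply: (subringX _ hB); apply: vB.
by apply: (map_f mvar); rewrite mem_enum.
Qed.

Lemma cmonom_mulI k : injective (mmul k).
Proof.
by move=> k1 k2 /eqP/cmP h; apply/eqP/cmP => i; have := h i; rewrite !cmM => /addnI.
Qed.

(** If products lie in [E] exactly when their factors do, this is the ideal generated by p and the
    monomials outside [E]. *)
Definition coef_ideal (E : set K) (p : set R) : set S :=
  [set F | forall k, E k -> p F@_k].

Lemma coef_ideal_ideal E p : is_ideal p ->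
  (forall k k', E (mmul k k') -> E k /\ E k') -> is_ideal (coef_ideal E p).
Proof.
move=> hp hE; have [p0 pD pM] := hp.
split=> [k _|F G hF hG k Ek|F G hG k Ek]; first by rewrite mcoeff0.
  by rewrite mcoeffD; apply: pD; [apply: hF|apply: hG].
rewrite mcoeffMl; apply: (@ideal_sum _ p) => // k1.
apply: (@ideal_sum _ p) => // k2; case: eqP => [ek|_]; last by rewrite mulr0n.
by rewrite mulr1n; apply: pM; apply: hG; have [] := hE k1 k2; rewrite ?ek.
Qed.

(* Gauss's lemma, by comparing the coefficients outside p of largest weight. *)
Lemma coef_ideal_prime E p : is_prime_ideal p -> E (@mone K) ->
  (forall k k', E (mmul k k') -> E k /\ E k') ->
  (forall k k', E k -> E k' -> E (mmul k k')) ->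
  is_prime_ideal (coef_ideal E p).
Proof.
move=> hp E1 hE EM; have [hpi p1 pM] := hp; have [p0 pD pZ] := hpi.
split; first exact: coef_ideal_ideal.
  by move=> /(_ (@mone K) E1); rewrite mcoeff1 eqxx.
move=> F G hFG; apply: contrapT => /not_orP[].
have [v hv] := separating_weight (msupp F ++ msupp G).
have top (H : S) : {subset msupp H <= msupp F ++ msupp G} -> ~ coef_ideal E p H ->
    exists M : K, [/\ M \in msupp H, E M, ~ p H@_M &
      forall k, k \in msupp H -> E k -> ~ p H@_k -> k != M ->
        (weight v k < weight v M)%N].
  move=> sH /existsNP[M0 /not_implyP[EM0 nM0]].
  have inH (k : K) : ~ p H@_k -> k \in msupp H.
    by move=> nk; rewrite -mcoeff_neq0; apply/eqP => h; apply: nk; rewrite h.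
  pose good (k : K) := `[< E k /\ ~ p H@_k >].
  pose hg n := has (fun k : K => good k && (weight v k == n)) (msupp H).
  have ex0 : exists n, hg n.
    exists (weight v M0); apply/hasP; exists M0; first exact: inH.
    by rewrite eqxx andbT; apply/asboolP.
  have bnd n : hg n -> (n <= \max_(k <- msupp H) weight v (k : K))%N.
    move=> /hasP[k hk /andP[_ /eqP<-]].
    exact: (@leq_bigmax_seq _ _ xpredT (fun k : K => weight v k) k hk isT).
  have [n /hasP[M hM /andP[/asboolP[EM' nM] /eqP Mn]] nmax] := ex_maxnP ex0 bnd.
  exists M; split=> // k hk Ek nk kM.
  rewrite ltn_neqAle Mn nmax ?andbT; last first.
    by apply/hasP; exists k; rewrite // eqxx andbT; apply/asboolP.
  by rewrite -Mn; apply: contra kM => /eqP/hv->//; apply: sH.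
move=> /top[|M [MF EM1 nM Mmax]]; first by move=> k hk; rewrite mem_cat hk.
move=> /top[|M' [MG EM2 nM' M'max]].
  by move=> k hk; rewrite mem_cat hk orbT.
suff h : p ((F * G)@_(mmul M M') - F@_M * G@_M').
  have : p (F@_M * G@_M').
    rewrite -[_ * _](subrK ((F * G)@_(mmul M M'))); apply: pD.
      by rewrite -opprB -mulN1r; apply: pZ.
    by apply: hFG; apply: EM.
  by case/pM.
rewrite mcoeffMl (big_fsetD1 M) //= (big_fsetD1 M') //= eqxx mulr1n.
have swap (x y z : R) : x + y + z - x = y + z by ring.
rewrite swap; apply: (pD).
  rewrite big_seq; apply: big_ind => // k; rewrite in_fsetD1 => /andP[kM' _].
  by rewrite (inj_eq (@cmonom_mulI M)) (negbTE kM') mulr0n.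
rewrite big_seq; apply: big_ind => // k1; rewrite in_fsetD1 => /andP[k1M k1F].
rewrite big_seq; apply: big_ind => // k2 k2G; case: eqP => [ek|_]; last by rewrite mulr0n.
rewrite mulr1n.
have [Ek1 Ek2] : E k1 /\ E k2 by apply: hE; rewrite ek; apply: EM.
have [pk1|npk1] := pselect (p F@_k1); first exact: idealMr.
have [pk2|npk2] := pselect (p G@_k2); first exact: pZ.
have lt1 := Mmax k1 k1F Ek1 npk1 k1M.
have ew : (weight v k1 + weight v k2 = weight v M + weight v M')%N.
  rewrite -!weightD; congr weight; apply/funext => i.
  by have /eqP/cmP/(_ i) := ek; rewrite !cmM.
have [k2M'|k2M'] := eqVneq k2 M'.
  by move: ew lt1; rewrite k2M' => /addIn->; rewrite ltnn.
have lt2 := M'max k2 k2G Ek2 npk2 k2M'.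
by move: ew lt1 lt2; lia.
Qed.

End MonoidAlgebra.

(** * The extended Rees algebra *)

Lemma additive_span0 (A : comPzRingType) (V : zmodType) (l : A -> V) (G : set A) :
  l 0 = 0 -> (forall x y, l (x + y) = l x + l y) ->
  (forall h g, G g -> l (h * g) = 0) -> forall z, span G z -> l z = 0.
Proof.
move=> l0 lD lG z hz; suff : forall h, l (h * z) = 0.
  by move=> /(_ 1); rewrite mul1r.
apply: (@span_min _ _ [set z | forall h, l (h * z) = 0] _ _ _ hz).
  split=> /= [h|x y hx hy h|b x hx h]; first by rewrite mulr0.
    by rewrite mulrDr lD hx hy addr0.
  by rewrite mulrA.
by move=> g Gg h; apply: lG.
Qed.

Definition cons_exponent s (n : nat) (m : 'I_s -> nat) : 'I_s.+1 -> nat :=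
  fun i => if unlift ord0 i is Some j then m j else n.

Lemma cons_exponent0 s n (m : 'I_s -> nat) : cons_exponent n m ord0 = n.
Proof. by rewrite /cons_exponent unlift_none. Qed.

Lemma cons_exponent_lift s n (m : 'I_s -> nat) i :
  cons_exponent n m (lift ord0 i) = m i.
Proof. by rewrite /cons_exponent liftK. Qed.

Lemma monomial_cons_exponent (A : comNzRingType) s (x : 'I_s.+1 -> A) n m :
  monomial x (cons_exponent n m) =
  x ord0 ^+ n * monomial (fun i => x (lift ord0 i)) m.
Proof.
rewrite /monomial big_ord_recl cons_exponent0; congr (_ * _).
by apply: eq_bigr => i _; rewrite cons_exponent_lift.
Qed.

Section Valuation.
Variables (R : comNzRingType) (s : nat) (a : 'I_s -> R) (w : 'I_s -> nat).
Variable p : set R.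
Hypothesis hR : noeth R.
Hypothesis hp : is_prime_ideal p.
Hypothesis hindep : forall (f : polynomials R s) (M : {cmonom 'I_s}),
  peval f a = 0 -> (forall m, m \in msupp f -> (weight w M <= weight w m)%N) ->
  p f@_M.

Local Notation K := {cmonom 'I_s.+1}.
Local Notation S := {malg R[K]}.

Let T : S := mvar R (@ord0 s).
Let X (i : 'I_s) : S := mvar R (lift (@ord0 s) i).

Let tail (k : K) : 'I_s -> nat := fun i => k (lift ord0 i).
Let tail_ext m n : tail (cmon (cons_exponent n m)) = m.
Proof. by apply/funext => i; rewrite /tail cmonE cons_exponent_lift. Qed.

Let tailM k k' : tail (mmul k k') = (fun i => tail k i + tail k' i)%N.
Proof. by apply/funext => i; rewrite /tail cmM. Qed.

Let monomial_ext m n : T ^+ n * monomial X m = << cmon (cons_exponent n m) >>.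
Proof. by rewrite -monomial_mvar monomial_cons_exponent. Qed.

(** Under X_i |-> a_i T^(- w_i) the monomial k acquires the T-exponent [k ord0] minus the weight of
    its tail. The test compares this with N - e, written additively to stay in the natural
    numbers. *)
Let lam_coef e N (k : K) : R :=
  if (k ord0 + e == weight w (tail k) + N)%N then monomial a (tail k) else 0.

Let additive_functional (c : K -> R) : exists l : S -> R,
  [/\ forall x k, l << x *g k >> = x * c k, l 0 = 0,
      forall F G, l (F + G) = l F + l G & forall F G, l (F - G) = l F - l G].
Proof.
exists (mmap idfun c); split.
- exact: mmapU.
- exact: mmap0.
- exact: mmapD.
- exact: mmapB.
Qed.

Definition rees_relations : set S :=
  span [set z | exists i, z = (a i)%:MP - T ^+ w i * X i].

Let functional_relations (l : nat -> nat -> S -> R) e N z :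
  (forall e N x k, l e N << x *g k >> = x * lam_coef e N k) ->
  (forall e N, l e N 0 = 0) ->
  (forall e N F G, l e N (F + G) = l e N F + l e N G) ->
  (forall e N F G, l e N (F - G) = l e N F - l e N G) ->
  rees_relations z -> l e N z = 0.
Proof.
move=> lU l0 lD lB hz.
apply: (additive_span0 (l0 e N) (lD e N) _ hz).
move=> h _ [i ->]; elim/malg_ind: h => [F G hF hG|c k].
  by rewrite mulrDl lD; apply: etrans (addr0 0); exact: (f_equal2 +%R hF hG).
have -> : T ^+ w i * X i = << cmon (cons_exponent (w i) (fun j => (j == i) : nat)) >>.
  by rewrite -monomial_ext monomial1.
set g := cmon _.
have e1 : l e N (<< c *g k >> * (a i)%:MP) = c * a i * lam_coef e N k.
  by rewrite malgUM mulm1 lU.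
have e2 : l e N (<< c *g k >> * << g >>) = c * lam_coef e N (mmul k g).
  by rewrite malgUM mulr1 lU.
rewrite mulrBr lB; apply/eqP; rewrite subr_eq0; apply/eqP.
apply: (etrans e1); apply: (etrans _ (esym e2)); rewrite -mulrA; congr (_ * _).
rewrite /lam_coef tailM tail_ext weightD weight1 monomialD monomial1.
rewrite cmM cmonE cons_exponent0.
have -> : (k ord0 + w i + e == weight w (tail k) + w i + N)%N =
          (k ord0 + e == weight w (tail k) + N)%N.
  by rewrite addnAC [(_ + w i + N)%N]addnAC eqn_add2r.
by case: ifP => _; rewrite ?mulr0 // mulrC.
Qed.

Let functional_shift (l : nat -> nat -> S -> R) e n u :
  (forall e N x k, l e N << x *g k >> = x * lam_coef e N k) ->
  (forall e N F G, l e N (F + G) = l e N F + l e N G) ->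
  l e n (T ^+ n * u) = l e 0%N u.
Proof.
move=> lU lD.
have -> : T ^+ n = << cmon (cons_exponent n (fun _ => 0%N)) >>.
  by rewrite -monomial_ext monomial0 mulr1.
elim/malg_ind: u => [F G hF hG|c k].
  by rewrite mulrDr !lD; exact: (f_equal2 +%R hF hG).
rewrite malgUM mul1r lU lU /lam_coef tailM tail_ext weightD weight0 add0n.
rewrite monomialD monomial0 mul1r cmM cmonE cons_exponent0 addn0.
by rewrite [(n + _)%N]addnC addnAC eqn_add2r.
Qed.

(** Setting T = 1 in the part of u that contributes to T^(-e) gives a relation f among the a_i. Its
    monomials have weight [k ord0 + e], so m0, being free of T, sits at minimal weight, and its
    coefficient is that of u. *)
Let functional_coef (l : nat -> nat -> S -> R) (u : S) (m0 : K) :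
  (forall e N x k, l e N << x *g k >> = x * lam_coef e N k) ->
  (forall e N, l e N 0 = 0) ->
  (forall e N F G, l e N (F + G) = l e N F + l e N G) ->
  m0 ord0 = 0%N -> l (weight w (tail m0)) 0%N u = 0 -> p u@_m0.
Proof.
move=> lU l0 lD m00 hu; set e := weight w (tail m0) in hu.
pose f : polynomials R s :=
  \sum_(k <- msupp u | (k ord0 + e)%N == weight w (tail k))
     << u@_k *g cmon (tail k) >>.
have fE m : f@_m = \sum_(k <- msupp u | (k ord0 + e)%N == weight w (tail k))
   u@_k *+ (cmon (tail k) == m).
  by rewrite raddf_sum; apply: eq_bigr => k _; apply: mcoeffU.
have tail_inj (k : K) : cmon (tail k) = cmon (tail m0) ->
    (k ord0 + e)%N == weight w (tail k) -> k = m0.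
  move=> tk ek.
  have tk' i : tail k i = tail m0 i by rewrite -[LHS]cmonE tk cmonE.
  have wk : weight w (tail k) = e by congr weight; apply/funext.
  apply/eqP/cmP => i; case: (unliftP ord0 i) => [j|] ->; first exact: tk'.
  by move: ek; rewrite wk m00 -[X in _ == X]add0n eqn_add2r => /eqP.
have <- : f@_(cmon (tail m0)) = u@_m0.
  rewrite fE big_mkcond; have [m0u|m0u] := boolP (m0 \in msupp u).
    rewrite (big_fsetD1 m0) // m00 add0n eqxx eqxx mulr1n big_seq big1 => [|k].
      exact: addr0.
    rewrite in_fsetD1 => /andP[/eqP km _]; case: ifP => // ek.
    by case: eqP => // tk; case: km; apply: tail_inj.
  rewrite (mcoeff_outdom m0u) big_seq big1 // => k ku.
  case: ifP => // ek; case: eqP => // tk.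
  by move: ku; rewrite (tail_inj k) ?(negbTE m0u).
apply: hindep => [|m].
  pose pe : {malg R[{cmonom 'I_s}]} -> R := 
    mmap idfun (fun m : {cmonom 'I_s} => monomial a m).
  have peU x (k : {cmonom 'I_s}) : pe << x *g k >> = x * monomial a k.
    exact: mmapU.
  have peD : {morph pe : F G / F + G} by exact: mmapD.
  have pe0 : pe 0 = 0 by exact: mmap0.
  rewrite -[peval f a]/(pe f) (big_morph pe peD pe0).
  rewrite -[RHS]hu [in RHS](monalgE u) (big_morph (l e 0%N) (lD e 0%N) (l0 e 0%N)).
  rewrite big_mkcond; apply: eq_bigr => k _; rewrite lU peU /lam_coef addn0.
  case: ifP => _; last by rewrite mulr0.
  by congr (_ * _); congr monomial; apply/funext => i; rewrite cmonE.
rewrite -mcoeff_neq0 fE => h.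
have -> : weight w (cmon (tail m0)) = e.
  by congr weight; apply/funext => i; rewrite cmonE.
rewrite leqNgt; apply: contraNN h => me; rewrite big1 // => k /eqP ek.
case: eqP => // tk; move: me; rewrite -tk.
have -> : weight w (cmon (tail k)) = weight w (tail k).
  by congr weight; apply/funext => i; rewrite cmonE.
by rewrite -ek ltnNge leq_addl.
Qed.

(** The ideal generated by T and p in the polynomial ring; it contains the relations by the case n =
    0 of [rees_relations_disjoint]. *)
Definition special_fiber : set S := coef_ideal [set k | k ord0 = 0%N] p.

Lemma special_fiber_prime : is_prime_ideal special_fiber.
Proof.
apply: coef_ideal_prime => //= [|k k'|k k' h h']; first exact: cm1.
  by rewrite cmM => /eqP; rewrite addn_eq0 => /andP[/eqP h /eqP h'].
by rewrite cmM h h'.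
Qed.

(* S maps to R[T, 1/T] by X_i |-> a_i T^(- w_i), with kernel containing the
   relations. Up to the factor T^(-e), the functional l e N gives the coefficient
   of T^(N - e) of the image. *)
Lemma rees_relations_disjoint n u : rees_relations (T ^+ n * u) -> special_fiber u.
Proof.
move=> h m m0.
have /choice[l0 hl0] : forall eN : nat * nat, exists l : S -> R,
    [/\ forall x k, l << x *g k >> = x * lam_coef eN.1 eN.2 k, l 0 = 0,
      forall F G, l (F + G) = l F + l G & forall F G, l (F - G) = l F - l G].
  by move=> eN; apply: additive_functional.
pose l e N := l0 (e, N).
have lU e N : forall x k, l e N << x *g k >> = x * lam_coef e N k.
  by case: (hl0 (e, N)).
have lz e N : l e N 0 = 0 by case: (hl0 (e, N)).
have lD e N : forall F G, l e N (F + G) = l e N F + l e N G.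
  by case: (hl0 (e, N)).
have lB e N : forall F G, l e N (F - G) = l e N F - l e N G.
  by case: (hl0 (e, N)).
apply: (functional_coef lU lz lD m0); rewrite -(functional_shift _ n u lU lD).
exact: (functional_relations _ _ lU lz lD lB h).
Qed.

End Valuation.

(** * Filtrations of R induced by t-adic ones *)

Lemma ipowD_sub (R : comPzRingType) (I : set R) m n :
  ipow I (m + n) `<=` imul (ipow I m) (ipow I n).
Proof.
elim: m => [|m IHm] x.
  by rewrite add0n => hx; rewrite -[x]mul1r; apply: mem_imul.
rewrite addSn /=; apply: imul_min; first exact: imul_ideal.
move=> y z hy /IHm.
apply: (@imul_min _ _ _ [set z | imul (ipow I m.+1) (ipow I n) (y * z)]).
  exact/colon_ideal/imul_ideal.
move=> u v hu hv; rewrite /= mulrA; apply: mem_imul => //.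
exact: mem_imul.
Qed.

Lemma ipow_map (R A : comPzRingType) (f : {rmorphism R -> A}) I J n x :
  is_ideal J -> (forall x, I x -> J (f x)) -> ipow I n x -> ipow J n (f x).
Proof.
move=> hJ h; elim: n x => [|n IHn] x //=.
apply: (@imul_min _ _ _ [set x | imul J (ipow J n) (f x)]) => [|y z hy hz /=].
  have [j0 jD jM] := imul_ideal J (ipow J n).
  split=> [|y z hy hz|b y hy] /=; first by rewrite rmorph0.
    by rewrite rmorphD; apply: jD.
  by rewrite rmorphM; apply: jM.
by rewrite rmorphM; apply: mem_imul; [apply: h|apply: IHn].
Qed.

Lemma ipow_localspan (A : comNzRingType) (P Q : set A) (t : A) e n :
  is_prime_ideal P -> ipow P e `<=` localspan P (Q `|` [set t]) ->
  ipow P (e * n) `<=` localspan P (Q `|` [set t ^+ n]).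
Proof.
move=> hP he; elim: n => [|n IHn] x.
  move=> _; rewrite -[x]mulr1.
  have [_ _ hM] := localspan_ideal hP (Q `|` [set t ^+ 0]).
  by apply: hM; apply: sub_localspan => //; right; rewrite /= expr0.
rewrite mulnS => /ipowD_sub; have hI := localspan_ideal hP (Q `|` [set t ^+ n.+1]).
have [_ iD iM] := hI.
apply: imul_min => // y z /he/(localspan_set1 hP)[u [r [nu hu]]].
move=> /IHn/(localspan_set1 hP)[v [r' [nv hv]]].
apply: (localspan_cancel hP nu); apply: (localspan_cancel hP nv).
have up : localspan P Q `<=` localspan P (Q `|` [set t ^+ n.+1]).
  by apply: localspanS => // q; left.
have -> : v * (u * (y * z)) = v * z * (u * y - r * t) +
    r * t * (v * z - r' * t ^+ n) + r * r' * t ^+ n.+1.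
  by rewrite exprS; ring.
apply: (iD); first by apply: (iD); apply: (iM); apply: up.
by apply: (iM); apply: sub_localspan => //; right.
Qed.

(* In A / Q localized at P, which is one-dimensional, P is nilpotent modulo t, so
   the t-adic filtration is linearly bounded below by the P-adic one. *)
Lemma exists_t_adic_filtration (R : comPzRingType) (A : comNzRingType)
    (f : {rmorphism R -> A}) (t : A) (J P : set A) (p : set R) :
  noeth A -> is_ideal J -> is_prime_ideal P -> P t ->
  (forall x, p x -> P (f x)) -> (forall n u, J (t ^+ n * u) -> P u) ->
  exists (V : nat -> set R) e,
    [/\ forall n, is_ideal (V n), forall n, V n.+1 `<=` V n,
        forall n, ipow p (e * n) `<=` V n &
        forall n x y, ~ P y -> J (t ^+ n * y - f x) -> ~ V n.+1 x].
Proof.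
move=> hA hJ hP Pt pP JP; have [hPi P1 PM] := hP.
(* With Q maximal among the ideals containing J and disjoint from this set, each nonzero ideal of
   A/Q localized at P contains a power of t, as [artin_tate] requires. *)
pose U := [set x | exists n u, ~ P u /\ x = t ^+ n * u].
have UP u : ~ P u -> U u by move=> nu; exists 0%N, u; rewrite expr0 mul1r.
have [Q [hQ JQ UQ hmax]] : exists Q, [/\ is_prime_ideal Q, J `<=` Q,
    forall x, U x -> ~ Q x & forall I, is_ideal I -> Q `<=` I -> ~ I `<=` Q ->
      exists2 x, U x & I x].
  apply: exists_prime_avoiding => //; first exact: UP.
    move=> _ _ [n [u [nu ->]]] [m [v [nv ->]]]; exists (n + m)%N, (u * v).
    by split=> [/PM[]//|]; rewrite exprD; ring.
  by move=> _ [n [u [nu ->]]] /JP.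
have QP : Q `<=` P by move=> x Qx; apply: contrapT => /UP/UQ.
have nQt : ~ Q t by apply: UQ; exists 1%N, 1; rewrite mulr1 expr1.
have [e he] : exists e, ipow P e `<=` localspan P (Q `|` [set t]).
  apply: (artin_tate hA hQ hP) => // I hI QI nIQ.
  by have [_ [n [u [nu ->]]] hu] := hmax I hI QI nIQ; exists n, u.
have [hQi Q1 QM] := hQ; have [_ QD QZ] := hQi.
have nQtn n : ~ Q (t ^+ n).
  by elim: n => [|n IHn]; rewrite ?expr0 // exprS => /QM[].
have clQ x : localspan P Q x -> Q x.
  move=> [u nu /(span_min hQi (fun _ h => h)) hu].
  by case/QM: hu => // /QP.
(* The contraction along f of the ideal generated by t^n in A/Q localized at P. *)
exists (fun n => [set x | localspan P (Q `|` [set t ^+ n]) (f x)]), e; split.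
- move=> n; have [i0 iD iM] := localspan_ideal hP (Q `|` [set t ^+ n]).
  split=> [|x y hx hy|b x hx] /=; first by rewrite rmorph0.
    by rewrite rmorphD; apply: iD.
  by rewrite rmorphM; apply: iM.
- move=> n x; apply: (localspan_min hP) => z [hz|->].
    by apply: sub_localspan => //; left.
  have [_ _ iM] := localspan_ideal hP (Q `|` [set t ^+ n]).
  by rewrite exprS; apply: iM; apply: sub_localspan => //; right.
- move=> n x /(ipow_map hPi pP) hx; exact: (ipow_localspan hP he hx).
- move=> n x y nPy hxy /(localspan_set1 hP)[u [r [nu /clQ hu]]].
  (* If f x were a multiple of t^(n+1) locally, t^n would cancel modulo the prime Q and put u y,
     hence y, into P. *)
  have : Q (t ^+ n * (u * y - r * t)).
    have -> : t ^+ n * (u * y - r * t) =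
        u * (t ^+ n * y - f x) + (u * f x - r * t ^+ n.+1).
      by rewrite exprS; ring.
    by apply: (QD) => //; apply: QZ; apply: JQ.
  case/QM => [/nQtn//|/QP huy].
  have : P (u * y).
    have [_ PD PZ] := hPi; rewrite -[u * y](subrK (r * t)).
    by apply: PD => //; apply: PZ.
  by case/PM.
Qed.

Lemma monomial_congruence (A : comNzRingType) (I : finType) (J : set A)
    (x y : I -> A) m : is_ideal J ->
  (forall i, J (x i - y i)) -> J (monomial x m - monomial y m).
Proof.
move=> [J0 JD JM] h.
have mulB (u u' v v' : A) : J (u - u') -> J (v - v') -> J (u * v - u' * v').
  move=> hu hv; have -> : u * v - u' * v' = v * (u - u') + u' * (v - v') by ring.
  by apply: (JD); apply: JM.
apply: (big_ind2 (fun u v => J (u - v))) => [|u u' v v'|i _].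
- by rewrite subrr.
- exact: mulB.
- elim: (m i) => [|n IHn]; first by rewrite !expr0 subrr.
  by rewrite !exprS; apply: mulB.
Qed.

Lemma monomialXM (A : comNzRingType) (I : finType) (t : A) (w : I -> nat)
    (x : I -> A) m :
  monomial (fun i => t ^+ w i * x i) m = t ^+ weight w m * monomial x m.
Proof.
rewrite /monomial /weight expr_sum -big_split /=; apply: eq_bigr => i _.
by rewrite exprMn -exprM mulnC.
Qed.

Lemma rmorph_monomial (R A : comNzRingType) (I : finType)
    (f : {rmorphism R -> A}) (x : I -> R) m :
  f (monomial x m) = monomial (fun i => f (x i)) m.
Proof. by rewrite rmorph_prod; apply: eq_bigr => i _; rewrite rmorphXn. Qed.

Section Filtration.
Variables (R : comNzRingType) (s : nat) (a : 'I_s -> R) (w : 'I_s -> nat).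
Variable p : set R.
Hypothesis hR : noeth R.
Hypothesis hp : is_prime_ideal p.
Hypothesis hindep : forall (f : polynomials R s) (M : {cmonom 'I_s}),
  peval f a = 0 -> (forall m, m \in msupp f -> (weight w M <= weight w m)%N) ->
  p f@_M.

(** Modulo the relations, f(a) is T^(weight of M) times a polynomial F outside the special fiber,
    because the coefficient of f at M reappears in F at a monomial free of T. *)
Lemma exists_independent_filtration : exists (V : nat -> set R) e,
  [/\ forall n, is_ideal (V n), forall n, V n.+1 `<=` V n,
      forall n, ipow p (e * n) `<=` V n &
      forall (f : polynomials R s) (M : {cmonom 'I_s}),
        (forall m, m \in msupp f -> (weight w M <= weight w m)%N) ->
        ~ p f@_M -> ~ V (weight w M).+1 (peval f a)].
Proof.
pose S : comNzRingType := {malg R[{cmonom 'I_s.+1}]}.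
pose T : S := mvar R (@ord0 s).
pose X (i : 'I_s) : S := mvar R (lift (@ord0 s) i).
pose phi : {rmorphism R -> S} := @malgC {cmonom 'I_s.+1} R.
pose J : set S := rees_relations a w.
have Jrel i : J (phi (a i) - T ^+ w i * X i) by apply: sub_span; exists i.
have [V [e [hV V1 V2 V3]]] : exists (V : nat -> set R) e,
    [/\ forall n, is_ideal (V n), forall n, V n.+1 `<=` V n,
        forall n, ipow p (e * n) `<=` V n &
        forall n x y, ~ special_fiber p (y : S) -> J (T ^+ n * y - phi x) ->
          ~ V n.+1 x].
  apply: exists_t_adic_filtration.
  - exact: noeth_malg.
  - exact: span_ideal.
  - exact: special_fiber_prime.
  - move=> k k0; rewrite mcoeffU1; case: eqP => [ek|_]; last by case: hp => -[].
    by have := cmUU (@ord0 s); rewrite ek k0.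
  - move=> x px k _; rewrite mcoeffC; case: eqP => _; last by case: hp => -[].
    by rewrite mulr1n.
  - exact: (rees_relations_disjoint hindep).
exists V, e; split=> // f M fM npM.
(* The T-exponent is the excess of the weight of m over that of M. The subtraction is exact on the
   support by [fM]. *)
pose b (m : {cmonom 'I_s}) := cons_exponent (weight w m - weight w M) m.
pose F : S := \sum_(m <- msupp f) phi f@_m * << cmon (b m) >>.
apply: (V3 _ _ F) => [hF|].
  apply: (npM); have FM : F@_(cmon (b M)) = \sum_(m <- msupp f)
      f@_m *+ (cmon (b m) == cmon (b M)).
    rewrite raddf_sum; apply: eq_bigr => m _.
    by rewrite -[LHS]/((f@_m)%:MP * << cmon (b m) >>)@_(cmon (b M)) mcoeffCM
      mcoeffU1 mulr_natr.
  have <- : F@_(cmon (b M)) = f@_M.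
    have [Mf|Mf] := boolP (M \in msupp f); last first.
      by case: npM; rewrite (mcoeff_outdom Mf); case: hp => -[].
    rewrite FM (big_fsetD1 M) // eqxx mulr1n big_seq big1 => [|m].
      exact: addr0.
    rewrite in_fsetD1 => /andP[/eqP mM _]; case: eqP => // /eqP/cmP e1.
    case: mM; apply/eqP/cmP => i.
    by have := e1 (lift ord0 i); rewrite !cmonE /b !cons_exponent_lift.
  by apply: hF; rewrite /= cmonE /b cons_exponent0 subnn.
have ringid (A : comNzRingType) (t c x y z : A) :
    t * (c * (x * y)) - c * z = c * (t * x * y - z) by ring.
have -> : T ^+ weight w M * F - phi (peval f a) = \sum_(m <- msupp f) phi f@_m *
    (T ^+ weight w m * monomial X m - phi (monomial a m)).
  rewrite rmorph_sum mulr_sumr -sumrB big_seq [RHS]big_seq.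
  apply: eq_bigr => m mf.
  have -> : << cmon (b m) >> = T ^+ (weight w m - weight w M) * monomial X m :> S.
    by rewrite -monomial_mvar monomial_cons_exponent.
  have -> : T ^+ weight w m = T ^+ weight w M * T ^+ (weight w m - weight w M).
    by rewrite -exprD subnKC // fM.
  rewrite rmorphM -/(monomial a m).
  exact: ringid.
have hJ : is_ideal J by apply: span_ideal.
have [_ _ JM] := hJ; apply: (@ideal_sum _ J) => // m; apply: (JM).
rewrite rmorph_monomial -monomialXM; apply: monomial_congruence => // i.
by rewrite -opprB -mulN1r; apply: (JM).
Qed.

End Filtration.

(** * Part (b) *)

Section Dependent.
Variables (R : comNzRingType) (s : nat).
Implicit Types (a : 'I_s -> R) (f : polynomials R s).

Lemma peval_add a f g :
  peval (f + g : {malg R[{cmonom 'I_s}]}) a = peval f a + peval g a.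
Proof. exact: (mmapD (f := idfun) (h := fun m : {cmonom 'I_s} => monomial a m)). Qed.

Lemma peval0 a : peval (0 : {malg R[{cmonom 'I_s}]}) a = 0.
Proof. exact: (mmap0 (f := idfun) (h := fun m : {cmonom 'I_s} => monomial a m)). Qed.

Lemma pevalU a c (k : {cmonom 'I_s}) :
  peval (<< c *g k >> : {malg R[{cmonom 'I_s}]}) a = c * monomial a k.
Proof. exact: (mmapU (f := idfun) (h := fun m : {cmonom 'I_s} => monomial a m)). Qed.

Lemma pevalUM a c (k : {cmonom 'I_s}) f :
  peval (<< c *g k >> * f : {malg R[{cmonom 'I_s}]}) a =
  c * monomial a k * peval f a.
Proof.
elim/malg_ind: f => [F G hF hG|d k'].
  rewrite mulrDr !peval_add mulrDr; exact: (f_equal2 +%R hF hG).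
have e1 : peval (<< c *g k >> * << d *g k' >> : {malg R[{cmonom 'I_s}]}) a =
    c * d * monomial a (mmul k k').
  by rewrite malgUM; apply: pevalU.
apply: (etrans e1); rewrite (pevalU a d k').
have -> : monomial a (mmul k k') = monomial a (fun i => k i + k' i)%N.
  by congr monomial; apply/funext => i; rewrite cmM.
by rewrite monomialD; ring.
Qed.

Lemma span_setU_seq (I : set R) (T : eqType) (l : seq T) (g : T -> R) x :
  is_ideal I -> uniq l -> span (I `|` [set g k | k in [set` l]]) x ->
  exists c : T -> R, I (x - \sum_(k <- l) c k * g k).
Proof.
move=> [I0 ID IM] ul; set Z := [set x | exists c, I (x - \sum_(k <- l) c k * g k)].
apply: (@span_min _ _ Z).
  split=> [|y z [c hc] [d hd]|b y [c hc]].
  - exists (fun _ => 0); rewrite big1 ?subr0 // => k _; exact: mul0r.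
  - exists (fun k => c k + d k).
    under eq_bigr => k _ do rewrite mulrDl.
    by rewrite big_split opprD addrACA; apply: ID.
  - exists (fun k => b * c k).
    under eq_bigr => k _ do rewrite -mulrA.
    by rewrite -mulr_sumr -mulrBr; apply: IM.
move=> y [Iy|[k0 k0l <-]].
  by exists (fun _ => 0); rewrite big1 ?subr0 // => k _; exact: mul0r.
exists (fun k => (k == k0)%:R); rewrite (bigD1_seq k0) //= eqxx mul1r.
by rewrite big1 ?addr0 ?subrr // => k /negbTE->; rewrite mul0r.
Qed.

Lemma length_ge_independent a (w : 'I_s -> nat) (p : set R) (V : nat -> set R)
    n (ks : seq {cmonom 'I_s}) :
  is_prime_ideal p -> (forall n, is_ideal (V n)) ->
  (forall n, V n.+1 `<=` V n) ->
  (forall f (M : {cmonom 'I_s}),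
     (forall m, m \in msupp f -> (weight w M <= weight w m)%N) ->
     ~ p f@_M -> ~ V (weight w M).+1 (peval f a)) ->
  uniq ks -> pairwise (fun k k' : {cmonom 'I_s} => weight w k' <= weight w k)%N ks ->
  (forall k : {cmonom 'I_s}, k \in ks -> weight w k < n)%N ->
  length_ge p (V n) (size ks).
Proof.
move=> hp hV VS hind uks pks kn.
have VD i j : (i <= j)%N -> V j `<=` V i.
  move=> /subnKC<-; elim: (j - i)%N => [|k IHk]; first by rewrite addn0.
  by rewrite addnS; apply: subset_trans IHk.
suff h r l : uniq (l ++ r) ->
    pairwise (fun k k' : {cmonom 'I_s} => weight w k' <= weight w k)%N (l ++ r) ->
    (forall k : {cmonom 'I_s}, k \in r -> weight w k < n)%N ->
    length_ge p (V n `|` [set monomial a (k : {cmonom 'I_s}) | k in [set` l]])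
      (size r).
  apply: (length_geS hp _ (h ks [::] uks pks kn)) => z hz.
  by apply: sub_localspan => //; left.
elim: r l {uks pks kn} => [|m r IHr] l //= ulr plr rn.
have [hm ul] : m \notin l /\ uniq l.
  move: ulr; rewrite cat_uniq => /and3P[ul /hasPn h _].
  by split=> //; apply: h; rewrite mem_head.
exists (monomial a m) => [[u npu /(span_setU_seq (hV n) ul)[c hc]]|]; last first.
  apply: (@length_geS _ _ hp _ (V n `|`
      [set monomial a (k : {cmonom 'I_s}) | k in [set` rcons l m]])).
    move=> z [[hz|[k kl <-]]|->]; apply: sub_localspan => //.
    - by left.
    - by right; exists k => //; rewrite /= mem_rcons inE (kl : k \in l) orbT.
    - by right; exists m => //; rewrite /= mem_rcons mem_head.
  by apply: IHr => [||k kr]; rewrite ?cat_rcons //; apply: rn; rewrite inE kr orbT.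
pose g : polynomials R s :=
  << u *g m >> - \sum_(k <- l) << c k *g k >> :> {malg R[{cmonom 'I_s}]}.
have gE k : g@_k = u *+ (m == k) - \sum_(j <- l) c j *+ (j == k).
  rewrite mcoeffB mcoeffU raddf_sum; congr (_ - _).
  by apply: eq_bigr => j _; apply: mcoeffU.
have gm : g@_m = u.
  rewrite gE eqxx mulr1n big_seq big1 ?subr0 // => j jl.
  by case: eqP => [jm|_]; [rewrite -jm jl in hm|rewrite mulr0n].
apply: (hind g m); last first.
- apply: (VD _ n); first by apply: rn; rewrite mem_head.
  suff -> : peval g a = u * monomial a m - \sum_(k <- l) c k * monomial a k by [].
  have -> : g = << u *g m >> + \sum_(k <- l) << - c k *g k >>
      :> {malg R[{cmonom 'I_s}]}.
    rewrite /g -sumrN; congr (_ + _); apply: eq_bigr => k _.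
    by rewrite monalgUN.
  rewrite peval_add pevalU; congr (_ + _); rewrite -sumrN.
  rewrite (big_morph _ (peval_add a) (peval0 a)); apply: eq_bigr => k _.
  by rewrite pevalU mulNr.
- by rewrite gm.
- move=> k; rewrite -mcoeff_neq0 gE.
  have [<- //|mk] := eqVneq m k; rewrite mulr0n sub0r oppr_eq0.
  have [kl _|kl] := boolP (k \in l).
    move: plr; rewrite pairwise_cat => /and3P[/allrelP h _ _].
    by apply: h => //; rewrite mem_head.
  rewrite big_seq big1 ?eqxx // => j jl.
  by case: eqP => // jk; rewrite -jk jl in kl.
Qed.

Lemma mcoeffUM c (k m : {cmonom 'I_s}) (f : {malg R[{cmonom 'I_s}]}) :
  (<< c *g k >> * f)@_(mmul k m) = c * f@_m.
Proof.
elim/malg_ind: f => [F G hF hG|d k'].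
  rewrite mulrDr !mcoeffD mulrDr; exact: (f_equal2 +%R hF hG).
by rewrite malgUM !mcoeffU (inj_eq (@cmonom_mulI _ k)) mulrnAr.
Qed.

Lemma weight_mmul (w : 'I_s -> nat) (k m : {cmonom 'I_s}) :
  weight w (mmul k m) = (weight w k + weight w m)%N.
Proof. by rewrite -weightD; congr weight; apply/funext => i; rewrite cmM. Qed.

Lemma msuppUM_weight (w : 'I_s -> nat) c (k : {cmonom 'I_s}) j
    (f : {malg R[{cmonom 'I_s}]}) :
  (forall m : {cmonom 'I_s}, m \in msupp f -> (j <= weight w m)%N) ->
  forall m, m \in msupp (<< c *g k >> * f) -> (weight w k + j <= weight w m)%N.
Proof.
move=> h m /msuppM_le[k1 [k2 [hk1 hk2 ->]]].
have -> : k1 = k.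
  by have := fsubsetP msuppU_le k1 hk1; rewrite in_fset1 => /eqP.
by rewrite weight_mmul leq_add2l h.
Qed.

(** [M] may lie outside the support, so a cancellation at [M] in a sum of relations simply yields
    the coefficient 0. *)
Definition initial_coefficients a (w : 'I_s -> nat) : set R :=
  [set c | exists f (M : {cmonom 'I_s}), [/\ peval f a = 0,
    forall m, m \in msupp f -> (weight w M <= weight w m)%N & f@_M = c]].

(* Multiplication by monomials brings two relations to the same exponent at
   minimal weight. *)
Lemma initial_coefficients_ideal a w : is_ideal (initial_coefficients a w).
Proof.
split=> [|c d [f [M [fa fM <-]]] [g [N [ga gN <-]]]|b c [f [M [fa fM <-]]]].
- exists (0 : {malg R[{cmonom 'I_s}]}), (cmon (fun _ => 0%N)).
  split=> [|m|]; [exact: peval0|by rewrite msupp0|exact: mcoeff0].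
- exists (<< 1 *g N >> * f + << 1 *g M >> * g : {malg R[{cmonom 'I_s}]}),
    (mmul M N); split.
  + have ef : peval (<< 1 *g N >> * f : {malg R[{cmonom 'I_s}]}) a = 0.
      by rewrite pevalUM fa mulr0.
    have eg : peval (<< 1 *g M >> * g : {malg R[{cmonom 'I_s}]}) a = 0.
      by rewrite pevalUM ga mulr0.
    by rewrite peval_add; apply: etrans (f_equal2 +%R ef eg) (addr0 0).
  + move=> m /(fsubsetP (msuppD_le _ _)); rewrite inE weight_mmul.
    by case/orP; [rewrite addnC|]; apply: msuppUM_weight.
  + have ef : (<< 1 *g N >> * f : {malg R[{cmonom 'I_s}]})@_(mmul M N) = f@_M.
      by rewrite mulmC mcoeffUM mul1r.
    have eg : (<< 1 *g M >> * g : {malg R[{cmonom 'I_s}]})@_(mmul M N) = g@_N.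
      by rewrite mcoeffUM mul1r.
    by rewrite mcoeffD; apply: (f_equal2 +%R ef eg).
- exists (<< b *g M >> * f : {malg R[{cmonom 'I_s}]}), (mmul M M); split.
  + by rewrite pevalUM fa mulr0.
  + by rewrite weight_mmul; apply: msuppUM_weight.
  + by rewrite mcoeffUM.
Qed.

(** A smaller prime over the parameters would itself have height at least d, pushing the height of p
    to d + 1. *)
Lemma minimal_prime_parameters (p : set R) d : noeth R -> is_prime_ideal p ->
  height_ge p d -> ~ height_ge p d.+1 ->
  exists b : 'I_d -> R, minimal_prime (span (range b)) p.
Proof.
move=> hR hp pd npd; have [b pb hb] := exists_parameters hR hp pd.
exists (fun i => b i); split=> //.
  by apply: span_min => [|_ [i _ <-]]; [case: hp|apply: pb].
move=> q hq bq qp; apply: contrapT => npq; apply: npd.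
apply: (@height_ge_ltS _ q) => //; apply: hb => // i hi.
by apply: bq; apply: sub_span; exists (Ordinal hi).
Qed.

Lemma card_box_monomials n (w : 'I_s -> nat) V : (0 < n)%N ->
  (\sum_i w i < V)%N -> exists ks : seq {cmonom 'I_s},
  [/\ uniq ks, pairwise (fun k k' : {cmonom 'I_s} => weight w k' <= weight w k)%N ks,
      forall k : {cmonom 'I_s}, k \in ks -> (weight w k < V * n)%N &
      size ks = (n ^ s)%N].
Proof.
move=> n0 wV; pose leT (k k' : {cmonom 'I_s}) := (weight w k' <= weight w k)%N.
pose ks0 := [seq cmon (fun i => f i : nat) | f : {ffun 'I_s -> 'I_n}].
have tr : transitive leT by move=> k1 k2 k3 h1 h2; apply: leq_trans h2 h1.
exists (sort leT ks0); split.
- rewrite sort_uniq map_inj_uniq ?enum_uniq // => f g /eqP/cmP h.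
  by apply/ffunP => i; apply: val_inj; have := h i; rewrite !cmonE.
- rewrite -(sorted_pairwise tr); apply: sort_sorted => k k'.
  exact: leq_total.
- move=> k; rewrite mem_sort => /mapP[f _ ->].
  apply: (@leq_ltn_trans ((\sum_i w i) * n)); last by rewrite ltn_pmul2r.
  rewrite big_distrl; apply: leq_sum => i _; rewrite cmonE mulnC.
  by rewrite leq_mul2l ltnW ?orbT.
- by rewrite size_sort size_map -cardE card_ffun !card_ord.
Qed.

Lemma weighted_dependent_of_dim a (w : nat -> nat) : noeth R ->
  weight_sequence w -> (forall n P, @is_prime_chain R n P -> (n < s)%N) ->
  weighted_dependent w a.
Proof.
move=> hR hw hdim; apply: contrapT => hdep.
pose ww (i : 'I_s) := w i.
have nI1 : ~ initial_coefficients a ww 1.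
  move=> [f [M [fa fM fM1]]]; apply: hdep; exists f; split=> //; exists M, 1.
  have Mf : M \in msupp f by rewrite -mcoeff_neq0 fM1 oner_eq0.
  rewrite mulr1 /initial_form mcoeffE Mf ifT //.
  by apply/allP => m; apply: fM.
(* With the multiplicative set {1}, a maximal ideal over the initial coefficients; these do not
   include 1, by independence. *)
have [||p [hp Ip _ _]] := @exists_prime_avoiding _ [set 1] _ hR
    (initial_coefficients_ideal a ww) erefl.
- by move=> x y -> ->; rewrite mulr1.
- by move=> x ->.
have [V [e [hV VS pV Vind]]] : exists (V : nat -> set R) e,
  [/\ forall n, is_ideal (V n), forall n, V n.+1 `<=` V n,
      forall n, ipow p (e * n) `<=` V n &
      forall (f : polynomials R s) (M : {cmonom 'I_s}),
        (forall m, m \in msupp f -> (weight ww M <= weight ww m)%N) ->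
        ~ p f@_M -> ~ V (weight ww M).+1 (peval f a)].
  apply: exists_independent_filtration => // f M fa fM.
  by apply: Ip; exists f, M.
have [d [ds pd npd]] : exists d, [/\ (d < s)%N, height_ge p d & ~ height_ge p d.+1].
  have ex0 : exists d, `[< height_ge p d >].
    by exists 0%N; apply/asboolP; exists (fun _ => p).
  have bnd d : `[< height_ge p d >] -> (d <= s)%N.
    by move=> /asboolP[P hP _]; apply/ltnW/(hdim d P).
  have [d /asboolP pd dmax] := ex_maxnP ex0 bnd; exists d; split=> //.
    by have [P hP _] := pd; apply: (hdim d P).
  by move=> /asboolP /dmax; rewrite ltnn.
have [b hb] := minimal_prime_parameters hR hp pd npd.
have hpi : is_ideal p by case: hp.
have pb i : p (b i) by case: hb => _ h _; apply: h; apply: sub_span; exists i.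
have [e' he'] := minimal_prime_localspan hR hb.
have {}he' : ipow p e' `<=` localspan p (set0 `|` range b) by rewrite set0U.
have [l hl] := length_ge_monomials hR hp (w := fun _ => 1%N) (fun _ => isT) he'.
pose W := (\sum_(i < s) ww i).+1.
(* The n^s monomials of the box have weight less than W n, so R/V(W n) has length at least n^s. As
   V(W n) contains p^(e W n), the parameters b bound this length by l (e W n)^d, and d + 1 <= s. *)
apply: (@not_linear_bound (l * (e * W) ^ d)%N d) => n n0.
have [ks [uks pks kn sks]] := card_box_monomials n0 (ltnSn (\sum_(i < s) ww i)%N).
have := length_ge_independent hp hV VS Vind uks pks kn.
rewrite sks => hlen.
apply: (@leq_trans (n ^ s)); first by rewrite leq_pexp2l.
rewrite -mulnA -expnMn -mulnA.
apply: (leq_trans (hl predT (e * (W * n))%N (n ^ s)%N _ _)).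
- move=> m _; apply: sub_localspan => //; right.
  by exists m => //; rewrite /= eqxx.
- apply: (length_geS hp _ hlen) => z [//|hz]; apply: sub_localspan => //.
  apply: pV; rewrite -[(e * (W * n))%N]mul1n in hz.
  exact: (monomials_ge_ipow hpi pb _ _ hz).
- rewrite leq_mul2l; apply/orP; right; apply: leq_trans (max_card _) _.
  by rewrite card_ffun !card_ord.
Qed.

End Dependent.

(** * The theorem *)

Section KrullDim.
Variable R : comPzRingType.

Let lengths : set nat := [set n | exists P : nat -> set R, is_prime_chain n P].

(** [supremum] is a choice among the suprema, so one has to be exhibited: the largest length of a
    chain, or +oo if the lengths are unbounded. *)
Let krull_dim_supremums : lengths !=set0 ->
  supremums [set (n%:Z)%:E%E | n in lengths] (krull_dim R).
Proof.
move=> [n0 hn0]; rewrite /krull_dim /supremum.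
rewrite ifF; last by apply/eqP => h0; have : (set0 : set (\bar int)) (n0%:Z)%:E%E
  by rewrite -h0; exists n0.
apply: xgetPex.
have [[m hm]|hunb] := pselect (exists m, forall n, lengths n -> (n <= m)%N).
  have ex0 : exists n, `[< lengths n >] by exists n0; apply/asboolP.
  have bnd n : `[< lengths n >] -> (n <= m)%N by move=> /asboolP/hm.
  have [k /asboolP hk kmax] := ex_maxnP ex0 bnd.
  exists (k%:Z)%:E%E; split=> [_ [n hn <-]|y hy]; last by apply: hy; exists k.
  by rewrite lee_fin lez_nat; apply: kmax; apply/asboolP.
exists +oo%E; split=> [y _|[r| |] hy]; rewrite ?leey //.
  case: hunb; exists `|r|%N => n hn.
  have : ((n%:Z)%:E <= r%:E)%E by apply: hy; exists n.
  by rewrite lee_fin; lia.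
by have : ((n0%:Z)%:E <= -oo :> \bar int)%E by apply: hy; exists n0.
Qed.

Lemma prime_chain_le_krull_dim n (P : nat -> set R) :
  is_prime_chain n P -> ((n%:Z)%:E <= krull_dim R)%E.
Proof.
move=> hP; have hn : lengths n by exists P.
by have [ub _] := krull_dim_supremums (ex_intro _ n hn); apply: ub; exists n.
Qed.

Lemma exists_prime_chain s : ((s%:Z)%:E <= krull_dim R)%E ->
  exists P : nat -> set R, is_prime_chain s P.
Proof.
move=> hs; apply: contrapT => hn.
have hlt n : lengths n -> (n < s)%N.
  move=> [P [hP hP']]; rewrite ltnNge; apply/negP => sn; apply: hn; exists P.
  by split=> i hi; [apply: hP|apply: hP']; apply: leq_trans sn.
have [h0|/set0P h0] := eqVneq lengths set0.
  move: hs; rewrite /krull_dim -/lengths h0 image_set0 supremum0.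
  by rewrite leeNy_eq.
have [_ lb] := krull_dim_supremums h0.
have /(le_trans hs) : (krull_dim R <= (s%:Z - 1)%:E)%E.
  by apply: lb => _ [n /hlt hn' <-]; rewrite lee_fin; lia.
by rewrite lee_fin; lia.
Qed.

End KrullDim.

Lemma theorem1p8_nontrivial (R : comNzRingType) (s : nat) (hR : noetherian R)
    (hs : (0 < s)%N) :
  (((s%:Z)%:E <= krull_dim R)%E ->
     exists a : 'I_s -> R,
       forall w : nat -> nat, weight_sequence w -> weighted_independent w a) /\
  ((krull_dim R < (s%:Z)%:E)%E ->
     forall (a : 'I_s -> R) (w : nat -> nat),
       weight_sequence w -> weighted_dependent w a).
Proof.
have hR' := noetherian_subT hR; split=> [/exists_prime_chain[P hP]|hdim a w hw].
  by case: s hs hP => // s _; apply: exists_weighted_independent.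
apply: weighted_dependent_of_dim => // n P /prime_chain_le_krull_dim hn.
by have := le_lt_trans hn hdim; rewrite lte_fin ltz_nat.
Qed.

Theorem theorem1p8 (R : comPzRingType) (s : nat) (hR : noetherian R)
    (hs : (0 < s)%N) :
  (((s%:Z)%:E <= krull_dim R)%E ->
     exists a : 'I_s -> R,
       forall w : nat -> nat, weight_sequence w -> weighted_independent w a) /\
  ((krull_dim R < (s%:Z)%:E)%E ->
     forall (a : 'I_s -> R) (w : nat -> nat),
       weight_sequence w -> weighted_dependent w a).
Proof.
(* In the zero ring (a) is vacuous for want of primes, and f = 0 proves (b) because 0 is
   invertible. *)
have [R0|R1] := eqVneq (1 : R) 0.
  split=> [/exists_prime_chain[P [hP _]]|_ a w hw].
    by have [[P0 _ _] P1 _] := hP 0%N (leq0n _); case: P1; rewrite R0.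
  exists (0 : {malg R[{cmonom 'I_s}]}); split.
    by rewrite /peval msupp0 big_seq_fset0.
  by exists (cmon (fun _ => 0%N)), 0; rewrite mulr0 R0.
pose R' : comNzRingType := HB.pack (GRing.ComPzRing.sort R)
  (GRing.ComPzRing.class R) (GRing.PzSemiRing_isNonZero.Build R R1).
exact: (@theorem1p8_nontrivial R' s hR hs).
Qed.
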